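(* Let $\mathcal H$ be a cosemisimple Hopf algebra which is weakly finite as an algebra, and let $\Lambda\in\mathcal H$ be an element of integral type. Then $S(\Lambda)=\Lambda$ if and only if $(1\otimes\Lambda)\Delta(\Lambda)=\Lambda\otimes\Lambda$. In particular, every finite-dimensional unimodular left coideal subalgebra $\mathcal A\subset\mathcal H$ satisfies $S^2(\mathcal A)=\mathcal A$, and every idempotent element of integral type in $\mathcal H$ is a two-sided group-like projection.
   Context: $k$ is a field; $\mathcal H$ is a Hopf algebra over $k$ with comultiplication $\Delta$, counit $\varepsilon$, invertible antipode $S$. A left coideal subalgebra is a subalgebra $\mathcal A\ni1$ with $\Delta(\mathcal A)\subset\mathcal H\otimes\mathcal A$. A non-zero $\Lambda$ is of integral type if $\Delta(\Lambda)(1\otimes\Lambda)=\Lambda\otimes\Lambda$. $\mathcal A$ is unimodular if $\{x\in\mathcal A: ax=\varepsilon(a)x\ \forall a\in\mathcal A\}=\{x\in\mathcal A: xa=\varepsilon(a)x\ \forall a\in\mathcal A\}$. A unital algebra is weakly finite if for all $n$ and $x,y\in M_n$ over it, $xy=1$ implies $yx=1$. A non-zero idempotent $P$ is a two-sided group-like projection if $\Delta(P)(1\otimes P)=(1\otimes P)\Delta(P)=P\otimes P$ and $\Delta(P)(P\otimes1)=(P\otimes1)\Delta(P)=P\otimes P$. *)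

(* Defs.v *)
(* Hopf algebras are not in the library: we define them here.
   Elements of H ⊗ H (resp. H ⊗ H ⊗ H) are represented by finite lists of
   pairs (triples) of elementary tensors; two such lists denote the same
   tensor iff they agree under every bilinear (trilinear) map into every
   F-vector space (universal property of the tensor product). *)
From HB Require Import structures.
From mathcomp Require Import all_boot all_order all_algebra.
Set Implicit Arguments. Unset Strict Implicit. Unset Printing Implicit Defensive.
Import Order.TTheory GRing.Theory Num.Theory.
Local Open Scope ring_scope.

Section Hopf.
Variables (F : fieldType) (H : algType F).

Definition bilinear_map (V : lmodType F) (phi : H -> H -> V) : Prop :=
  (forall (c : F) x y z, phi (c *: x + y) z = c *: phi x z + phi y z) /\
  (forall (c : F) x y z, phi z (c *: x + y) = c *: phi z x + phi z y).

Definition trilinear_map (V : lmodType F) (phi : H -> H -> H -> V) : Prop :=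
  (forall (c : F) x y z w, phi (c *: x + y) z w = c *: phi x z w + phi y z w) /\
  (forall (c : F) x y z w, phi z (c *: x + y) w = c *: phi z x w + phi z y w) /\
  (forall (c : F) x y z w, phi z w (c *: x + y) = c *: phi z w x + phi z w y).

Definition teq (t u : seq (H * H)) : Prop :=
  forall (V : lmodType F) (phi : H -> H -> V), bilinear_map phi ->
    \sum_(p <- t) phi p.1 p.2 = \sum_(p <- u) phi p.1 p.2.

Definition teq3 (t u : seq (H * H * H)) : Prop :=
  forall (V : lmodType F) (phi : H -> H -> H -> V), trilinear_map phi ->
    \sum_(p <- t) phi p.1.1 p.1.2 p.2 = \sum_(p <- u) phi p.1.1 p.1.2 p.2.

Variables (Delta : H -> seq (H * H)) (eps : H -> F) (S : H -> H).

Definition is_hopf : Prop :=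
  (forall (c : F) x y,
     teq (Delta (c *: x + y)) ([seq (c *: p.1, p.2) | p <- Delta x] ++ Delta y)) /\
  (forall x, teq3 [seq (q.1, q.2, p.2) | p <- Delta x, q <- Delta p.1]
                  [seq (p.1, q.1, q.2) | p <- Delta x, q <- Delta p.2]) /\
  (forall (c : F) x y, eps (c *: x + y) = c * eps x + eps y) /\
  (forall x, \sum_(p <- Delta x) eps p.1 *: p.2 = x) /\
  (forall x, \sum_(p <- Delta x) eps p.2 *: p.1 = x) /\
  (forall x y, teq (Delta (x * y)) [seq (p.1 * q.1, p.2 * q.2) | p <- Delta x, q <- Delta y]) /\
  teq (Delta 1) [:: (1, 1)] /\
  (forall x y, eps (x * y) = eps x * eps y) /\
  eps 1 = 1 /\
  (forall (c : F) x y, S (c *: x + y) = c *: S x + S y) /\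
  (forall x, \sum_(p <- Delta x) S p.1 * p.2 = eps x *: 1) /\
  (forall x, \sum_(p <- Delta x) p.1 * S p.2 = eps x *: 1) /\
  bijective S.

Definition subspace (C : H -> Prop) : Prop :=
  C 0 /\ forall (c : F) x y, C x -> C y -> C (c *: x + y).

Definition subcoalgebra (C : H -> Prop) : Prop :=
  subspace C /\
  forall x, C x -> exists t : seq (H * H),
    (forall p, p \in t -> C p.1 /\ C p.2) /\ teq (Delta x) t.

Definition simple_subcoalgebra (C : H -> Prop) : Prop :=
  subcoalgebra C /\ (exists x, C x /\ x <> 0) /\
  forall D : H -> Prop, subcoalgebra D -> (forall x, D x -> C x) ->
    (forall x, D x -> x = 0) \/ (forall x, C x -> D x).

Definition cosemisimple : Prop :=
  forall h : H, exists s : seq H, h = \sum_(x <- s) x /\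
    forall x, x \in s -> exists C, simple_subcoalgebra C /\ C x.

Definition weakly_finite : Prop :=
  forall (n : nat) (x y : 'M[H]_n), x *m y = 1%:M -> y *m x = 1%:M.

Definition integral_type (L : H) : Prop :=
  L <> 0 /\ teq [seq (p.1, p.2 * L) | p <- Delta L] [:: (L, L)].

Definition left_coideal_subalgebra (A : H -> Prop) : Prop :=
  subspace A /\ A 1 /\ (forall x y, A x -> A y -> A (x * y)) /\
  forall a, A a -> exists t : seq (H * H),
    (forall p, p \in t -> A p.2) /\ teq (Delta a) t.

Definition finite_dim (A : H -> Prop) : Prop :=
  exists (n : nat) (v : 'I_n -> H), (forall i, A (v i)) /\
    forall a, A a -> exists c : 'I_n -> F, a = \sum_(i < n) c i *: v i.

Definition unimodular (A : H -> Prop) : Prop :=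
  forall x, A x ->
    ((forall a, A a -> a * x = eps a *: x) <-> (forall a, A a -> x * a = eps a *: x)).

Definition two_sided_grouplike_projection (P : H) : Prop :=
  P <> 0 /\ P * P = P /\
  teq [seq (p.1, p.2 * P) | p <- Delta P] [:: (P, P)] /\
  teq [seq (p.1, P * p.2) | p <- Delta P] [:: (P, P)] /\
  teq [seq (p.1 * P, p.2) | p <- Delta P] [:: (P, P)] /\
  teq [seq (P * p.1, p.2) | p <- Delta P] [:: (P, P)].

End Hopf.

(* Main.v *)
Require Import Defs.
From HB Require Import structures.
From mathcomp Require Import all_boot all_order all_algebra.
From mathcomp Require Import boolp classical_sets zify.
Set Implicit Arguments. Unset Strict Implicit. Unset Printing Implicit Defensive.
Import GRing.Theory.
Local Open Scope ring_scope.

(* Let h be the Haar functional of the cosemisimple Hopf algebra H.  The key fact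
   is that (x, y) |-> h(xy) is nondegenerate on every finite-dimensional left
   coideal subalgebra A.  Otherwise its right radical contains a minimal nonzero
   left ideal and left coideal I of A.  Let W be a simple A-module maximizing
   t / s, where s = dim W and t = dim Hom_A(I, W); the trivial module shows that
   t >= s.  Then I^s is generated by t elements, and these generators give a
   surjection of free H-modules of the same rank st.  By weak finiteness it is
   bijective, which, by minimality of I, forces the generators to satisfy no
   relation over A.  Hence t dim A <= s dim I, so I = A, against h(1) = 1.

   An integral L of A then has h(L) <> 0, and the identity
   y_1 h(x y_2) = S(x_1) h(x_2 y) gives h(L) S(x) = L_1 h(x L_2) for x in A and,
   when L is also a right integral, h(L) x = S(L_1) h(L_2 x); all the claims
   about S(L) and S^2(A) are read off from these two formulas. *)

(** * Linear functionals *)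

(** Weak finiteness only speaks of square matrices, which is why I^s and the ratio t / s appear. A
    finite-dimensional A-module M is generated by t elements as soon as dim Hom_A(M, W') <= t dim W'
    for every simple W': both sides are dim End(W') times the multiplicity of W' in the top of M,
    respectively of A^t, so the criterion holds over any field. For M = I^s it reads s dim Hom_A(I,
    W') <= t dim W', which is exactly the maximality of t / s. Let e_1, .., e_t be a basis of
    Hom_A(I, W) and g_1, .., g_t generators of I^s. The coordinates of (id (x) e_b) Delta(g_j) form
    a matrix over H whose rows are indexed by a generator and a coordinate of W, and whose columns
    are indexed by a homomorphism and a copy of I; both number st. The rows span because the
    antipode inverts Delta and the e_b are independent. Once the matrix is invertible, a relation
    with coefficients y_j in A gives (id (x) rho) Delta(y_j) = 0, where rho is the action on W; the
    counit and the minimality of I turn this into y_j = 0. *)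

Section LinearPredicates.
Variables (F : fieldType) (V W : lmodType F).

Lemma linear_sumZ (f : V -> W) (I : Type) (r : seq I) (P : pred I) (c : I -> F)
    (v : I -> V) : linear f ->
  f (\sum_(i <- r | P i) c i *: v i) = \sum_(i <- r | P i) c i *: f (v i).
Proof.
move=> lf; pose g : {linear V -> W} := HB.pack f (GRing.isLinear.Build F V W _ f lf).
by rewrite -[f]/(g : V -> W) linear_sum; apply: eq_bigr => i _; rewrite linearZ.
Qed.

Lemma linear_sumE (f : V -> W) (I : Type) (r : seq I) (P : pred I)
    (v : I -> V) : linear f ->
  f (\sum_(i <- r | P i) v i) = \sum_(i <- r | P i) f (v i).
Proof.
move=> lf; pose g : {linear V -> W} := HB.pack f (GRing.isLinear.Build F V W _ f lf).
by rewrite -[f]/(g : V -> W) linear_sum.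
Qed.

Lemma linear_Z (f : V -> W) c v : linear f -> f (c *: v) = c *: f v.
Proof.
move=> lf; pose g : {linear V -> W} := HB.pack f (GRing.isLinear.Build F V W _ f lf).
by rewrite -[f]/(g : V -> W) linearZ.
Qed.

Lemma linear_B (f : V -> W) u v : linear f -> f (u - v) = f u - f v.
Proof.
move=> lf; pose g : {linear V -> W} := HB.pack f (GRing.isLinear.Build F V W _ f lf).
by rewrite -[f]/(g : V -> W) linearB.
Qed.

Lemma linear_0 (f : V -> W) : linear f -> f 0 = 0.
Proof. by move=> lf; rewrite -(subrr 0) linear_B ?subrr. Qed.

End LinearPredicates.

Section ScalarPredicates.
Variables (F : fieldType) (V : lmodType F) (f : V -> F).
Hypothesis sf : scalar f.

Lemma scalar_sumZ (I : Type) (r : seq I) (P : pred I) (c : I -> F) (v : I -> V) :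
  f (\sum_(i <- r | P i) c i *: v i) = \sum_(i <- r | P i) c i * f (v i).
Proof. exact: (@linear_sumZ F V F^o). Qed.

Lemma scalar_sumE (I : Type) (r : seq I) (P : pred I) (v : I -> V) :
  f (\sum_(i <- r | P i) v i) = \sum_(i <- r | P i) f (v i).
Proof. exact: (@linear_sumE F V F^o). Qed.

Lemma scalar_Z c v : f (c *: v) = c * f v.
Proof. exact: (@linear_Z F V F^o). Qed.

Lemma scalar_B u v : f (u - v) = f u - f v.
Proof. exact: (@linear_B F V F^o). Qed.

Lemma scalar_0 : f 0 = 0.
Proof. exact: (@linear_0 F V F^o). Qed.

End ScalarPredicates.

Section Functionals.
Variables (F : fieldType) (V : lmodType F).
Implicit Types (phi : V -> F) (E A : V -> Prop).

Definition lin_subspace E := E 0 /\ forall (c : F) x y, E x -> E y -> E (c *: x + y).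

Lemma subspace_sum E (I : Type) (r : seq I) (P : pred I) (c : I -> F) (v : I -> V) :
  lin_subspace E -> (forall i, P i -> E (v i)) ->
  E (\sum_(i <- r | P i) c i *: v i).
Proof.
move=> [E0 EL] Ev; elim: r => [|i r IH]; first by rewrite big_nil.
by rewrite big_cons; case: ifP => // Pi; apply: EL => //; exact: Ev.
Qed.

Lemma subspaceZ E c x : lin_subspace E -> E x -> E (c *: x).
Proof. by move=> [E0 EL] Ex; rewrite -[_ *: _]addr0; apply: EL. Qed.

Lemma subspaceD E x y : lin_subspace E -> E x -> E y -> E (x + y).
Proof. by move=> [E0 EL] Ex Ey; rewrite -[x]scale1r; apply: EL. Qed.

Lemma subspaceB E x y : lin_subspace E -> E x -> E y -> E (x - y).
Proof. by move=> [E0 EL] Ex Ey; rewrite addrC -scaleN1r; apply: EL. Qed.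

Lemma maximal_avoiding_subspace E v : lin_subspace E -> ~ E v ->
  exists M, [/\ lin_subspace M, forall x, E x -> M x, ~ M v &
    forall M', lin_subspace M' -> (forall x, M x -> M' x) -> ~ M' v ->
      forall x, M' x -> M x].
Proof.
move=> sE Ev.
pose P (X : set V) := X = set0 \/ [/\ lin_subspace X, forall x, E x -> X x & ~ X v].
have [|A [PA Amax]] := @Zorn_bigcup V P.
  move=> /= C CP Ctot.
  have [[X [CX [x Xx]]]|nX] := EM (exists X, C X /\ exists x, X x); last first.
    left; apply/seteqP; split=> // x [X CX Xx].
    by case: nX; exists X; split=> //; exists x.
  right.
  have good Y y : C Y -> Y y -> [/\ lin_subspace Y, forall x, E x -> Y x & ~ Y v].
    by move=> CY Yy; have [Y0|//] := CP _ CY; rewrite Y0 in Yy.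
  have [[X0 XL] EX Xv] := good _ _ CX Xx.
  split; first split.
  - by exists X.
  - move=> c y z [Y CY Yy] [Z CZ Zz].
    have [[Y0 YL] EY Yv] := good _ _ CY Yy.
    have [[Z0 ZL] EZ Zv] := good _ _ CZ Zz.
    have [YZ|ZY] := Ctot Y Z CY CZ.
    + by exists Z => //; apply: ZL => //; exact: YZ.
    + by exists Y => //; apply: YL => //; exact: ZY.
  - by move=> y Ey; exists X => //; exact: EX.
  - by move=> [Y CY Yv]; have [_ _] := good _ _ CY Yv; exact.
have [A0|[sA EA Av]] := PA.
  exfalso; apply: (Amax E); last by right; split.
  by rewrite A0; split=> // /(_ 0 (proj1 sE)).
exists A; split=> // M' sM' AM' M'v x M'x.
have [//|Ax] := EM (A x).
exfalso; apply: (Amax M'); first by split=> // /(_ x M'x).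
by right; split=> // y /EA /AM'.
Qed.

Lemma separating_functional E v : lin_subspace E -> ~ E v ->
  exists phi, [/\ scalar phi, forall x, E x -> phi x = 0 & phi v = 1].
Proof.
move=> sE Ev.
have [M [sM EM_ Mv Mmax]] := maximal_avoiding_subspace sE Ev.
(* By maximality V = M + F v: for x outside [M] the space M + F x, which is [M'], must contain v. *)
have dec x : exists l, M (x - l *: v).
  have [Mx|Mx] := EM (M x); first by exists 0; rewrite scale0r subr0.
  pose M' y := exists c, M (y - c *: x).
  have sM' : lin_subspace M'.
    split; first by exists 0; rewrite scale0r subr0; case: sM.
    move=> c y z [a Ma] [b Mb]; exists (c * a + b).
    have -> : c *: y + z - (c * a + b) *: x = c *: (y - a *: x) + (z - b *: x).
      by rewrite scalerDl scalerBr scalerA opprD addrACA.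
    by case: sM => _; exact.
  have [[c Mc]|M'v] := EM (M' v); last first.
    case: Mx; apply: (Mmax M') => //.
    - by move=> y My; exists 0; rewrite scale0r subr0.
    - by exists 1; rewrite scale1r subrr; case: sM.
  have c0 : c != 0 by apply/eqP => c0; apply: Mv; move: Mc; rewrite c0 scale0r subr0.
  exists c^-1; have := subspaceZ (- c^-1) sM Mc.
  by rewrite scalerBr scalerA mulNr mulVf // !scaleNr scale1r opprK addrC.
have [phi phiP] := choice dec.
have uniq x l : M (x - l *: v) -> phi x = l.
  move=> Ml; apply/eqP; rewrite -subr_eq0; apply/negP => /negP d0; apply: Mv.
  have := subspaceB sM Ml (phiP x).
  rewrite opprB addrC addrA subrK -scalerBl => /(subspaceZ (phi x - l)^-1 sM).
  by rewrite scalerA mulVf // scale1r.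
exists phi; split.
- move=> c x y; apply: uniq; rewrite scalerDl -scalerA opprD addrACA -scalerBr.
  by case: sM => _; apply.
- by move=> x Ex; apply: uniq; rewrite scale0r subr0; exact: EM_.
- by apply: uniq; rewrite scale1r subrr; case: sM.
Qed.

Lemma functional_separates x : (forall phi, scalar phi -> phi x = 0) -> x = 0.
Proof.
move=> phi0; apply: contrapT => x0.
have s0 : lin_subspace (fun y => y = 0).
  by split=> // c y z -> ->; rewrite scaler0 addr0.
have [phi [sphi _ /eqP]] := separating_functional s0 x0.
by rewrite phi0 // eq_sym oner_eq0.
Qed.

(** A basis of [A] with its dual basis, the latter extended to all of [V], so that it can be applied
    to legs of a comultiplication lying outside [A]. *)
Definition coordinates A n (a : 'I_n -> V) (xi : 'I_n -> V -> F) :=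
  [/\ forall i, A (a i), forall i, scalar (xi i),
      forall i j, xi i (a j) = (i == j)%:R &
      forall x, A x -> x = \sum_i xi i x *: a i].

Definition in_span k (s : 'I_k -> V) x := exists c : 'I_k -> F, x = \sum_i c i *: s i.

(** A biorthogonal family in [A] of maximal size spans [A]. Sizes are bounded by [k] because
    expanding the family in [s] factors an identity matrix through dimension [k]. *)
Lemma coordinates_exist A k (s : 'I_k -> V) : lin_subspace A ->
  (forall x, A x -> in_span s x) -> exists n a xi, @coordinates A n a xi.
Proof.
move=> sA As.
pose P n := `[< exists (a : 'I_n -> V) xi, [/\ forall i, A (a i), forall i, scalar (xi i) &
      forall i j, xi i (a j) = (i == j)%:R] >].
have exP : exists n, P n.
  exists 0%N; apply/asboolP; exists (fun=> 0), (fun _ _ => 0).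
  by split; case.
have Pk n : P n -> (n <= k)%N.
  move=> /asboolP [a [xi [Aa sxi axi]]].
  have /choice [C CE] : forall i, in_span s (a i) by move=> i; exact: As.
  pose CM := \matrix_(i < n, j < k) C i j; pose XM := \matrix_(j < k, i < n) xi i (s j).
  have : CM *m XM = 1%:M.
    apply/matrixP => i j; rewrite !mxE eq_sym -axi CE.
    by rewrite (scalar_sumZ (sxi j)); apply: eq_bigr => l _; rewrite !mxE.
  by move=> /mulmx1_min.
case: (ex_maxnP exP Pk) => n /asboolP [a [xi [Aa sxi axi]]] nmax.
exists n, a, xi; split=> // x Ax; apply: contrapT => xn.
(* A missed [x] would enlarge the family: all [xi i] vanish on [y], while [phi] below vanishes on
   the span [E] of the family and is 1 at [y]. *)
pose y := x - \sum_i xi i x *: a i.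
pose E z := z = \sum_i xi i z *: a i.
have sE : lin_subspace E.
  split; first by rewrite /E big1 // => i _; rewrite (scalar_0 (sxi i)) scale0r.
  move=> c u v Eu Ev; rewrite /E {1}Eu {1}Ev scaler_sumr -big_split /=.
  by apply: eq_bigr => i _; rewrite sxi scalerDl scalerA.
have [phi [sphi phiE phix]] := separating_functional sE xn.
have Ea i : E (a i).
  rewrite /E (bigD1 i) //= axi eqxx scale1r big1 ?addr0 // => j ji.
  by rewrite axi (negPf ji) scale0r.
have phiy : phi y = 1.
  rewrite /y (scalar_B sphi) (scalar_sumZ sphi).
  by rewrite big1 ?subr0 // => i _; rewrite phiE ?mulr0.
have xiy i : xi i y = 0.
  rewrite /y (scalar_B (sxi i)) (scalar_sumZ (sxi i)).
  rewrite (bigD1 i) //= axi eqxx mulr1 big1 ?addr0 ?subrr // => j ji.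
  by rewrite axi eq_sym (negPf ji) mulr0.
have : P n.+1.
  apply/asboolP; exists (fun i => oapp a y (unlift ord0 i)), (fun i => oapp xi phi (unlift ord0 i)).
  split.
  - move=> i; case: unliftP => [j _|_] //=.
    by apply: subspaceB => //; apply: subspace_sum.
  - by move=> i; case: unliftP => [j _|_] //=.
  - move=> i j; case: unliftP => [i' ->|->]; case: unliftP => [j' ->|->] //=.
    by rewrite phiE.
by move=> /nmax; rewrite ltnn.
Qed.

(** The transition matrices satisfy C D = 1; since [n <= n'] they are square, and D C = 1 writes the
    basis of [A] in that of [A']. *)
Lemma coordinates_eq A A' n a xi n' a' xi' :
  lin_subspace A' ->
  @coordinates A n a xi -> @coordinates A' n' a' xi' -> (n <= n')%N ->
  (forall x, A' x -> A x) -> forall x, A x -> A' x.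
Proof.
move=> sA' [Aa sxi axi Ae] [A'a sxi' axi' A'e] nn' A'A x Ax.
pose C := \matrix_(i < n', j < n) xi j (a' i).
pose D := \matrix_(j < n, i < n') xi' i (a j).
have CD : C *m D = 1%:M.
  apply/matrixP => i j; rewrite !mxE eq_sym -axi' (Ae (a' i)); last exact: A'A.
  rewrite (scalar_sumZ (sxi' j)).
  by apply: eq_bigr => l _; rewrite !mxE.
have nE : n = n' by apply/eqP; rewrite eqn_leq nn' /=; exact: mulmx1_min CD.
subst n'; have DC := mulmx1C CD.
have aE j : a j = \sum_i xi' i (a j) *: a' i.
  under eq_bigr => i _ do rewrite (Ae (a' i) (A'A _ (A'a i))) scaler_sumr.
  rewrite exchange_big /= {1}[a j](Ae _ (Aa j)); apply: eq_bigr => l _.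
  have := congr1 (fun M : 'M_n => M j l) DC; rewrite !mxE => e.
  transitivity ((\sum_i xi' i (a j) * xi l (a' i)) *: a l); last first.
    by rewrite scaler_suml; apply: eq_bigr => i _; rewrite scalerA.
  rewrite axi eq_sym -e; congr (_ *: _); apply: eq_bigr => i _; by rewrite !mxE.
rewrite (Ae x Ax); apply: subspace_sum => // j _.
by rewrite aE; apply: subspace_sum.
Qed.

End Functionals.

(** * Sums over the comultiplication *)

Section Cop.
Variables (F : fieldType) (H : algType F) (Delta : H -> seq (H * H)).

(** Sweedler notation: this is Phi(x_1, x_2). For bilinear [Phi] it depends only on the tensor that
    the list [Delta x] represents. *)
Definition cosum (V : lmodType F) (Phi : H -> H -> V) (x : H) : V :=
  \sum_(p <- Delta x) Phi p.1 p.2.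

Lemma eq_cosum (V : lmodType F) (Phi Psi : H -> H -> V) x :
  (forall a b, Phi a b = Psi a b) -> cosum Phi x = cosum Psi x.
Proof. by move=> e; apply: eq_bigr => p _; exact: e. Qed.

Lemma cosum_out (V W : lmodType F) (f : V -> W) (Phi : H -> H -> V) x : linear f ->
  f (cosum Phi x) = cosum (fun a b => f (Phi a b)) x.
Proof. by move=> lf; rewrite /cosum linear_sumE. Qed.

Lemma cosum_scale (V : lmodType F) (Phi : H -> H -> V) c x :
  cosum (fun a b => c *: Phi a b) x = c *: cosum Phi x.
Proof. by rewrite /cosum scaler_sumr. Qed.

Lemma cosum_mull (Phi : H -> H -> H) c x :
  cosum (fun a b => c * Phi a b) x = c * cosum Phi x.
Proof. by rewrite /cosum mulr_sumr. Qed.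

Lemma cosum_mulr (Phi : H -> H -> H) c x :
  cosum (fun a b => Phi a b * c) x = cosum Phi x * c.
Proof. by rewrite /cosum mulr_suml. Qed.

Lemma cosum_scalar (V : lmodType F) (Phi : H -> H -> F) (v : V) x :
  cosum (fun a b => Phi a b *: v) x = (cosum (Phi : H -> H -> F^o) x) *: v.
Proof. by rewrite /cosum scaler_suml. Qed.

Lemma cosum_exchange (V : lmodType F) (g : H -> H -> H -> H -> V) x y :
  cosum (fun a b => cosum (g a b) y) x = cosum (fun c d => cosum (fun a b => g a b c d) x) y.
Proof. exact: exchange_big. Qed.

Lemma cosum_fun_linear (U V : lmodType F) (g : U -> H -> H -> V) x :
  (forall a b, linear (fun u => g u a b)) -> linear (fun u => cosum (g u) x).
Proof.
move=> lg c u v; rewrite /cosum scaler_sumr -big_split /=.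
by apply: eq_bigr => p _; exact: lg.
Qed.

Lemma bilinearI (V : lmodType F) (Phi : H -> H -> V) :
  (forall z, linear (fun x => Phi x z)) -> (forall z, linear (Phi z)) ->
  bilinear_map Phi.
Proof. by move=> hl hr; split=> c x y z; [exact: hl|exact: hr]. Qed.

Lemma trilinearI (V : lmodType F) (g : H -> H -> H -> V) :
  (forall z w, linear (fun x => g x z w)) -> (forall z w, linear (fun x => g z x w)) ->
  (forall z w, linear (g z w)) -> trilinear_map g.
Proof.
by move=> h1 h2 h3; split; [|split] => c x y z w; [exact: h1|exact: h2|exact: h3].
Qed.

Lemma bilinear_l (V : lmodType F) (Phi : H -> H -> V) z :
  bilinear_map Phi -> linear (fun x => Phi x z).
Proof. by case=> h _ c x y; exact: h. Qed.
Lemma bilinear_r (V : lmodType F) (Phi : H -> H -> V) z :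
  bilinear_map Phi -> linear (Phi z).
Proof. by case=> _ h c x y; exact: h. Qed.

Lemma lin_mull (V : lmodType F) (f : V -> H) a : linear f -> linear (fun x => a * f x).
Proof. by move=> lf c x y; rewrite lf mulrDr -scalerAr. Qed.
Lemma lin_mulr (V : lmodType F) (f : V -> H) a : linear f -> linear (fun x => f x * a).
Proof. by move=> lf c x y; rewrite lf mulrDl -scalerAl. Qed.
Lemma lin_scale (U V : lmodType F) (f : V -> U) a : linear f -> linear (fun x => a *: f x).
Proof. by move=> lf c x y; rewrite lf scalerDr !scalerA mulrC. Qed.
Lemma lin_scalar (U V : lmodType F) (f : V -> F) (v : U) : scalar f -> linear (fun x => f x *: v).
Proof. by move=> lf c x y; rewrite lf scalerDl scalerA. Qed.
Lemma lin_comp (U V W : lmodType F) (g : V -> W) (f : U -> V) :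
  linear g -> linear f -> linear (fun x => g (f x)).
Proof. by move=> lg lf c x y; rewrite lf lg. Qed.
Lemma sca_comp (U V : lmodType F) (g : V -> F) (f : U -> V) :
  scalar g -> linear f -> scalar (fun x => g (f x)).
Proof. by move=> lg lf c x y; rewrite lf lg. Qed.
Lemma sca_mull (V : lmodType F) (f : V -> F) a : scalar f -> scalar (fun x => a * f x).
Proof. by move=> lf c x y; rewrite lf mulrDr mulrCA. Qed.
Lemma sca_mulr (V : lmodType F) (f : V -> F) a : scalar f -> scalar (fun x => f x * a).
Proof. by move=> lf c x y; rewrite lf mulrDl mulrA. Qed.
Lemma sca_sum (V : lmodType F) (I : Type) (r : seq I) (P : pred I) (f : I -> V -> F) :
  (forall i, scalar (f i)) -> scalar (fun x => \sum_(i <- r | P i) f i x).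
Proof.
move=> lf c x y; rewrite mulr_sumr -big_split; apply: eq_bigr => i _; exact: lf.
Qed.

End Cop.

Section Hopf.
Variables (F : fieldType) (H : algType F).
Variables (Delta : H -> seq (H * H)) (eps : H -> F) (S : H -> H).
Hypothesis hopf : is_hopf Delta eps S.
Local Notation cop := (cosum Delta).

Lemma cosum_linear (V : lmodType F) (Phi : H -> H -> V) :
  bilinear_map Phi -> linear (cop Phi).
Proof.
move=> bPhi c x y; case: hopf => [/(_ c x y V Phi bPhi) + _].
rewrite /cop big_cat big_map /= => ->; rewrite scaler_sumr; congr (_ + _).
by apply: eq_bigr => p _; rewrite (linear_Z c p.1 (bilinear_l p.2 bPhi)).
Qed.

Lemma cosum_coassoc (V : lmodType F) (g : H -> H -> H -> V) x : trilinear_map g ->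
  cop (fun a b => cop (fun c d => g c d b) a) x =
  cop (fun a b => cop (fun c d => g a c d) b) x.
Proof.
move=> tg; case: hopf => _ [/(_ x V g tg) + _].
by rewrite !big_allpairs_dep.
Qed.

Lemma cosum_mul (V : lmodType F) (Phi : H -> H -> V) x y : bilinear_map Phi ->
  cop Phi (x * y) = cop (fun a b => cop (fun c d => Phi (a * c) (b * d)) y) x.
Proof.
move=> bPhi; case: hopf => _ [_ [_ [_ [_ [/(_ x y V Phi bPhi) + _]]]]].
by rewrite big_allpairs_dep.
Qed.

Lemma cosum_1 (V : lmodType F) (Phi : H -> H -> V) : bilinear_map Phi -> cop Phi 1 = Phi 1 1.
Proof.
move=> bPhi; case: hopf => _ [_ [_ [_ [_ [_ [/(_ V Phi bPhi) + _]]]]]].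
by rewrite big_seq1.
Qed.

Lemma eps_scalar : scalar eps. Proof. by case: hopf => _ [_ []]. Qed.
Lemma eps_mul x y : eps (x * y) = eps x * eps y.
Proof. by case: hopf => _ [_ [_ [_ [_ [_ [_ [-> _]]]]]]]. Qed.
Lemma eps_1 : eps 1 = 1.
Proof. by case: hopf => _ [_ [_ [_ [_ [_ [_ [_ [-> _]]]]]]]]. Qed.
Lemma antipode_linear : linear S.
Proof. by case: hopf => _ [_ [_ [_ [_ [_ [_ [_ [_ [h _]]]]]]]]]. Qed.
Lemma counitl x : cop (fun a b => eps a *: b) x = x.
Proof. by case: hopf => _ [_ [_ [h _]]]; exact: h. Qed.
Lemma counitr x : cop (fun a b => eps b *: a) x = x.
Proof. by case: hopf => _ [_ [_ [_ [h _]]]]; exact: h. Qed.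
Lemma antipodel x : cop (fun a b => S a * b) x = eps x *: 1.
Proof. by case: hopf => _ [_ [_ [_ [_ [_ [_ [_ [_ [_ [h _]]]]]]]]]]; exact: h. Qed.
Lemma antipoder x : cop (fun a b => a * S b) x = eps x *: 1.
Proof. by case: hopf => _ [_ [_ [_ [_ [_ [_ [_ [_ [_ [_ [h _]]]]]]]]]]]; exact: h. Qed.

End Hopf.

(** * Automatic proofs of linearity for expressions in Sweedler sums *)

Ltac lin1 h :=
  first [exact h | exact (antipode_linear h) | exact (eps_scalar h)
        | exact (bilinear_l _ h) | exact (bilinear_r _ h) | exact (h _)].

Ltac lin_hyp := match goal with h : _ |- _ => solve [lin1 h] end.

(* A bare [intros] would unfold [GRing.linear_for]. *)
Ltac lin := cbn beta;
  lazymatch goal with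
  | |- forall _, _ => intro; lin
  | |- bilinear_map _ => apply bilinearI; lin
  | |- trilinear_map _ => apply trilinearI; lin
  | |- GRing.linear_for _ _ => first
     [ by []
     | lin_hyp
     | match goal with
       | |- GRing.linear_for _ (fun x => ?a * @?f x) =>
          first [(apply (@lin_mull _ _ _ f a)) | (apply (@sca_mull _ _ f a))]; lin
       | |- GRing.linear_for _ (fun x => @?f x * ?a) =>
          first [(apply (@lin_mulr _ _ _ f a)) | (apply (@sca_mulr _ _ f a))]; lin
       | |- GRing.linear_for _ (fun x => ?a *: @?f x) => (apply (@lin_scale _ _ _ f a)); lin
       | |- GRing.linear_for _ (fun x => @?f x *: ?a) => (apply (@lin_scalar _ _ _ f a)); lin
       | |- GRing.linear_for _ (fun x => cosum ?D ?g (@?f x)) =>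
          (apply (@lin_comp _ _ _ _ (cosum D g) f));
          [match goal with hp : is_hopf _ _ _ |- _ => (apply (cosum_linear hp)) end|]; lin
       | |- GRing.linear_for _ (fun x => cosum ?D (@?g x) ?y) =>
          (apply (@cosum_fun_linear _ _ D _ _ g y)); lin
       | |- GRing.linear_for _ (cosum ?D ?g) =>
          match goal with hp : is_hopf _ _ _ |- _ => (apply (cosum_linear hp)) end; lin
       | |- GRing.linear_for _ (fun x => ?G (@?f x) ?b) =>
          first [(apply (@lin_comp _ _ _ _ (fun y => G y b) f))
                |(apply (@sca_comp _ _ _ (fun y => G y b) f))]; lin
       | |- GRing.linear_for _ (fun x => ?G (@?f x)) =>
          first [(apply (@lin_comp _ _ _ _ G f)) | (apply (@sca_comp _ _ _ G f))]; lin
       end]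
  | |- _ => idtac
  end.

(** * The antipode reverses products *)

Section Antipode.
Variables (F : fieldType) (H : algType F).
Variables (Delta : H -> seq (H * H)) (eps : H -> F) (S : H -> H).
Hypothesis hopf : is_hopf Delta eps S.
Local Notation cop := (cosum Delta).

(** Both sides equal [T], which is S(x_1 y_1) x_2 y_2 S(y_3) S(x_3): cancelling the factors on the
    right leaves S(x y), cancelling those on the left leaves S(y) S(x). *)
Lemma antipode_mul x y : S (x * y) = S y * S x.
Proof.
pose T := cop (fun a b => cop (fun c d => S (a * c) *
  cop (fun b1 b2 => cop (fun d1 d2 => (b1 * d1) * (S d2 * S b2)) d) b) y) x.
have lS := antipode_linear hopf; have le := eps_scalar hopf.
have SZ c v : S (c *: v) = c *: S v by exact: linear_Z.
transitivity T.
  have inner b d : cop (fun b1 b2 => cop (fun d1 d2 => (b1 * d1) * (S d2 * S b2)) d) b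
      = (eps b * eps d) *: 1.
    transitivity (cop (fun b1 b2 => (b1 * (eps d *: 1)) * S b2) b).
      apply: eq_cosum => b1 b2; rewrite -(antipoder hopf d) -cosum_mull -cosum_mulr.
      by apply: eq_cosum => d1 d2; rewrite !mulrA.
    transitivity (cop (fun b1 b2 => eps d *: (b1 * S b2)) b).
      by apply: eq_cosum => b1 b2; rewrite -scalerAr mulr1 scalerAl.
    by rewrite cosum_scale (antipoder hopf) scalerA mulrC.
  have -> : x * y = cop (fun a b => cop (fun c d => (eps b * eps d) *: (a * c)) y) x.
    rewrite -[in LHS](counitr hopf x) -cosum_mulr; apply: eq_cosum => a b.
    rewrite -[in LHS](counitr hopf y) -cosum_mull; apply: eq_cosum => c d.
    by rewrite -scalerAl -scalerAr scalerA.
  rewrite cosum_out //; apply: eq_cosum => a b; rewrite cosum_out //; apply: eq_cosum => c d.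
  by rewrite inner -scalerAr mulr1 SZ.
have TE : T = cop (fun a b => cop (fun c d =>
     cop (fun a1 a2 => cop (fun c1 c2 => S (a1 * c1) * (a2 * c2)) c) a * (S d * S b)) y) x.
  transitivity (cop (fun a b => cop (fun b1 b2 => cop (fun c d => cop (fun d1 d2 =>
     S (a * c) * (b1 * d1 * (S d2 * S b2))) d) y) b) x).
    apply: eq_cosum => a b; rewrite cosum_exchange; apply: eq_cosum => c d.
    by rewrite -cosum_mull; apply: eq_cosum => b1 b2; rewrite -cosum_mull.
  rewrite -(cosum_coassoc hopf (g := fun a b1 b2 => cop (fun c d => cop (fun d1 d2 =>
     S (a * c) * (b1 * d1 * (S d2 * S b2))) d) y)); last by lin.
  apply: eq_cosum => a b.
  transitivity (cop (fun c d => cop (fun a1 a2 => cop (fun c1 c2 =>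
     S (a1 * c) * (a2 * c1 * (S c2 * S b))) d) a) y); first by rewrite cosum_exchange.
  transitivity (cop (fun a1 a2 => cop (fun c d => cop (fun c1 c2 =>
     S (a1 * c1) * (a2 * c2 * (S d * S b))) c) y) a).
    rewrite cosum_exchange; apply: eq_cosum => a1 a2.
    rewrite -(cosum_coassoc hopf (g := fun c c1 c2 => S (a1 * c) * (a2 * c1 * (S c2 * S b)))) //.
    by lin.
  rewrite cosum_exchange; apply: eq_cosum => c d.
  rewrite -cosum_mulr; apply: eq_cosum => a1 a2; rewrite -cosum_mulr; apply: eq_cosum => c1 c2.
  by rewrite !mulrA.
rewrite TE.
transitivity (cop (fun a b => cop (fun c d => (eps a * eps c) *: (S d * S b)) y) x).
  apply: eq_cosum => a b; apply: eq_cosum => c d.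
  rewrite -[cop _ a](cosum_mul hopf (Phi := fun u v => S u * v)); last by lin.
  by rewrite (antipodel hopf) (eps_mul hopf) -scalerAl mul1r.
transitivity (S (cop (fun c d => eps c *: d) y) * S (cop (fun a b => eps a *: b) x)); last first.
  by rewrite !(counitl hopf).
rewrite [S (cop _ x)]cosum_out // -cosum_mull; apply: eq_cosum => a b.
rewrite [S (cop _ y)]cosum_out // -cosum_mulr; apply: eq_cosum => c d.
by rewrite !SZ -scalerAl -scalerAr scalerA mulrC.
Qed.
End Antipode.

(** * Slices and the Haar functional *)

Section Slices.
Variables (F : fieldType) (H : algType F) (Delta : H -> seq (H * H)).

Definition left_slice (phi : H -> F) (x : H) : H := cosum Delta (fun a b => phi a *: b) x.
Definition right_slice (phi : H -> F) (x : H) : H := cosum Delta (fun a b => phi b *: a) x.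
(** For a subspace this means that Delta(A) lies in H (x) A, tested by functionals on the first
    leg. *)
Definition costable (A : H -> Prop) := forall phi, scalar phi ->
  forall x, A x -> A (left_slice phi x).

End Slices.

Section Hopf.
Variables (F : fieldType) (H : algType F).
Variables (Delta : H -> seq (H * H)) (eps : H -> F) (S : H -> H).
Hypothesis hopf : is_hopf Delta eps S.
Local Notation cop := (cosum Delta).
Local Notation lslice := (left_slice Delta).
Local Notation rslice := (right_slice Delta).
Local Notation costable := (costable Delta).

Lemma lslice_linear phi : scalar phi -> linear (lslice phi).
Proof. by move=> sphi; rewrite /left_slice; lin. Qed.
Lemma rslice_linear phi : scalar phi -> linear (rslice phi).
Proof. by move=> sphi; rewrite /right_slice; lin. Qed.

Lemma scalar_lslice psi phi x : scalar psi ->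
  psi (lslice phi x) = cop (fun a b => phi a * psi b : F^o) x.
Proof.
move=> spsi; rewrite /left_slice (@cosum_out _ _ _ H F^o psi) //.
by apply: (@eq_cosum F H Delta F^o) => a b; rewrite scalar_Z.
Qed.

Lemma scalar_rslice psi phi x : scalar psi ->
  psi (rslice phi x) = cop (fun a b => phi b * psi a : F^o) x.
Proof.
move=> spsi; rewrite /right_slice (@cosum_out _ _ _ H F^o psi) //.
by apply: (@eq_cosum F H Delta F^o) => a b; rewrite scalar_Z.
Qed.

Lemma eps_lslice phi x : scalar phi -> eps (lslice phi x) = phi x.
Proof.
move=> sphi; rewrite scalar_lslice; last exact: eps_scalar hopf.
rewrite -{2}(counitr hopf x) (@cosum_out _ _ _ H F^o phi) //.
apply: (@eq_cosum F H Delta F^o) => a b.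
by rewrite scalar_Z // mulrC.
Qed.

Lemma rslice_lslice lam phi x : scalar lam -> scalar phi ->
  rslice lam (lslice phi x) = lslice phi (rslice lam x).
Proof.
move=> sl sp; have lr := rslice_linear sl; have ll := lslice_linear sp.
transitivity (cop (fun a b => rslice lam (phi a *: b)) x); first exact: cosum_out.
transitivity (cop (fun a b => lslice phi (lam b *: a)) x); last by symmetry; exact: cosum_out.
transitivity (cop (fun a b => cop (fun c d => phi a *: (lam d *: c)) b) x).
  by apply: eq_cosum => a b; rewrite cosum_scale (linear_Z _ _ lr).
rewrite -(cosum_coassoc hopf (g := fun a c d => phi a *: (lam d *: c))); last by lin.
apply: eq_cosum => a b; rewrite (linear_Z _ _ ll) -cosum_scale.
by apply: eq_cosum => c d; rewrite !scalerA mulrC.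
Qed.

(** The second entries of the list [Delta x] need not lie in [A]. Rewriting the first entries in a
    basis [b] of their span turns the second ones into left slices of [x], which do. *)
Lemma cosum_expand A n a xi (V : lmodType F) (Phi : H -> H -> V) x :
  @coordinates F H A n a xi -> costable A -> A x -> bilinear_map Phi ->
  cop Phi x = \sum_i Phi (rslice (xi i) x) (a i).
Proof.
move=> [Aa sxi _ Ae] cA Ax bPhi.
pose s (i : 'I_(size (Delta x))) := (tnth (in_tuple (Delta x)) i).1.
have sS : lin_subspace (in_span s).
  split; first by exists (fun=> 0); rewrite big1 // => i _; rewrite scale0r.
  move=> c u v [f ->] [g ->]; exists (fun i => c * f i + g i).
  rewrite scaler_sumr -big_split /=; apply: eq_bigr => i _.
  by rewrite scalerDl scalerA.
have [//|m [b [be [_ sbe _ be_e]]]] := coordinates_exist (s := s) sS.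
have dec p : p \in Delta x -> p.1 = \sum_i be i p.1 *: b i.
  move=> pD; apply: be_e.
  have /tnthP [j ->] : p \in in_tuple (Delta x) by [].
  exists (fun i => (i == j)%:R); rewrite (bigD1 j) //= eqxx scale1r big1 ?addr0 // => i /negPf ->.
  by rewrite scale0r.
have copE (W : lmodType F) (Psi : H -> H -> W) : bilinear_map Psi ->
    cop Psi x = \sum_i Psi (b i) (lslice (be i) x).
  move=> bPsi.
  transitivity (\sum_(p <- Delta x) \sum_i be i p.1 *: Psi (b i) p.2).
    rewrite /cosum big_seq [RHS]big_seq; apply: eq_bigr => p pD.
    by rewrite {1}(dec p pD) (linear_sumZ _ _ _ _ (bilinear_l p.2 bPsi)).
  rewrite exchange_big; apply: eq_bigr => i _ /=.
  by rewrite (linear_sumZ _ _ _ _ (bilinear_r (b i) bPsi)).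
rewrite copE //.
transitivity (\sum_i \sum_j xi j (lslice (be i) x) *: Phi (b i) (a j)).
  apply: eq_bigr => i _; rewrite {1}(Ae (lslice (be i) x)); last exact: cA.
  by rewrite (linear_sumZ _ _ _ _ (bilinear_r (b i) bPhi)).
rewrite exchange_big; apply: eq_bigr => j _ /=.
have -> : rslice (xi j) x = \sum_i xi j (lslice (be i) x) *: b i.
  by rewrite /right_slice copE //; have := sxi j; lin.
by rewrite (linear_sumZ _ _ _ _ (bilinear_l (a j) bPhi)).
Qed.

(** Every phi(x) is the counit of a left slice of [x]. *)
Lemma separated_costable A : costable A -> (forall x, A x -> eps x = 0) -> forall x, A x -> x = 0.
Proof.
move=> cA Ae x Ax; apply: functional_separates => phi sphi.
by rewrite -eps_lslice // Ae //; exact: cA.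
Qed.

(** * Construction of the Haar functional *)

Section Haar.
Hypothesis cosemi : cosemisimple Delta.

Fixpoint sum_of (Cs : seq (H -> Prop)) (x : H) : Prop :=
  if Cs is C :: Cs' then exists y z, [/\ C y, sum_of Cs' z & x = y + z] else x = 0.

Fixpoint nontrivial_simples (Cs : seq (H -> Prop)) : Prop :=
  if Cs is C :: Cs' then [/\ simple_subcoalgebra Delta C, ~ C 1 & nontrivial_simples Cs']
  else True.

Lemma sum_of_subspace Cs : nontrivial_simples Cs -> lin_subspace (sum_of Cs).
Proof.
elim: Cs => [_|C Cs IH] /=; first by split=> // c x y -> ->; rewrite scaler0 addr0.
move=> [[[[C0 CL] _] _] _ /IH [K0 KL]]; split; first by exists 0, 0; rewrite addr0.
move=> c _ _ [y [z [Cy Kz ->]]] [y' [z' [Cy' Kz' ->]]].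
exists (c *: y + y'), (c *: z + z'); split; [exact: CL|exact: KL|].
by rewrite scalerDr addrACA.
Qed.

Lemma lslice_sum_of Cs phi : nontrivial_simples Cs -> scalar phi ->
  (forall x, sum_of Cs x -> phi x = 0) -> forall x, sum_of Cs x -> lslice phi x = 0.
Proof.
elim: Cs => [_ sphi _ x ->|C Cs IH] /=; first by rewrite (linear_0 (lslice_linear sphi)).
move=> [[[[C0 CL] Ccop] _] _ sCs] sphi phi0 x [y [z [Cy Kz ->]]].
have lE := lslice_linear sphi.
rewrite -[y]scale1r lE scale1r (IH sCs sphi _ z Kz) ?addr0; last first.
  by move=> w Kw; apply: phi0; exists 0, w; rewrite add0r.
have [t [Ct Dt]] := Ccop y Cy.
rewrite /left_slice /cosum (Dt H (fun a b => phi a *: b)); last by lin.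
rewrite big_seq big1 // => p /Ct [Cp1 _]; rewrite phi0 ?scale0r //.
by exists p.1, 0; rewrite addr0; split=> //; case: (sum_of_subspace sCs).
Qed.

Lemma subcoalgebra_costable C : subcoalgebra Delta C -> costable C.
Proof.
move=> [sC Ccop] phi sphi x Cx; have [t [Ct Dt]] := Ccop x Cx.
rewrite /left_slice /cosum (Dt H (fun a b => phi a *: b)); last by lin.
rewrite big_seq; apply: (@subspace_sum F H C _ _ (fun p => p \in t) (fun p => phi p.1) snd) => //.
by move=> p /Ct [].
Qed.

(** If 1 = y + z with y in [C] and z in the remaining sum, slicing by a functional that kills this
    sum and is 1 at 1 gives 1 = the slice of y, which lies in [C]. *)
Lemma one_notin_sum_of Cs : nontrivial_simples Cs -> ~ sum_of Cs 1.
Proof.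
elim: Cs => [_ /eqP|C Cs IH] /=; first by rewrite oner_eq0.
move=> [sC C1 sCs] [y [z [Cy Kz yz]]].
have [phi [sphi phi0 phi1]] := separating_functional (sum_of_subspace sCs) (IH sCs).
apply: C1; have lE := lslice_linear sphi.
have := lE 1 y z; rewrite !scale1r -yz (lslice_sum_of sCs sphi phi0 Kz) addr0.
rewrite {1}/left_slice (cosum_1 hopf); last by lin.
rewrite phi1 scale1r => ->; apply: subcoalgebra_costable => //; by case: sC.
Qed.

(** [h] kills the sum [K] of the simple subcoalgebras that do not contain 1. As [K] is a sum of
    subcoalgebras, invariance holds there with both sides 0. *)
Lemma haar_exists : exists h : H -> F,
  [/\ scalar h, h 1 = 1 & forall x, rslice h x = h x *: 1].
Proof.
pose K x := exists Cs, nontrivial_simples Cs /\ sum_of Cs x.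
have Kcat Cs Cs' x y : nontrivial_simples Cs -> nontrivial_simples Cs' ->
    sum_of Cs x -> sum_of Cs' y -> nontrivial_simples (Cs ++ Cs') /\ sum_of (Cs ++ Cs') (x + y).
  elim: Cs x => [|C Cs IH] x /=; first by move=> _ s' -> Ky; rewrite add0r.
  move=> [sC C1 sCs] sCs' [u [v [Cu Kv ->]]] Ky.
  have [nCC Kvy] := IH _ sCs sCs' Kv Ky; split=> //.
  by exists u, (v + y); rewrite addrA.
have sK : lin_subspace K.
  split; first by exists [::].
  move=> c x y [Cs [sCs Kx]] [Cs' [sCs' Ky]].
  have [a b] := Kcat _ _ (c *: x) y sCs sCs' (subspaceZ c (sum_of_subspace sCs) Kx) Ky.
  by exists (Cs ++ Cs').
have K1 : ~ K 1 by move=> [Cs [/one_notin_sum_of]].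
have [h [sh hK h1]] := separating_functional sK K1.
exists h; split=> // x.
have lR := rslice_linear sh.
have [s [-> sP]] := cosemi x.
rewrite (linear_sumE _ _ _ lR) (scalar_sumE sh) scaler_suml.
rewrite big_seq [RHS]big_seq; apply: eq_bigr => y /sP [C [sC Cy]].
have [C1|C1] := EM (C 1); last first.
  have KC z : C z -> K z.
    by move=> Cz; exists [:: C] => /=; split=> //; exists z, 0; rewrite addr0.
  rewrite hK ?scale0r; last exact: KC.
  case: sC => [[_ /(_ y Cy) [t [Ct Dt]]] _].
  rewrite /right_slice /cosum (Dt H (fun a b => h b *: a)); last by lin.
  by rewrite big_seq big1 // => p /Ct [_ /KC /hK ->]; rewrite scale0r.
case: sC => [[[C0 CL] _]] [_ Csimple].
(* By simplicity a [C] that contains 1 is the line F 1, where invariance is h(1) = 1. *)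
have sub1 : subcoalgebra Delta (fun z => exists c, z = c *: 1).
  split; first split; first by exists 0; rewrite scale0r.
    by move=> c _ _ [a ->] [b ->]; exists (c * a + b); rewrite scalerA scalerDl.
  move=> _ [c ->]; exists [:: (c *: 1, 1)]; split.
    move=> p; rewrite inE => /eqP -> /=; split; first by exists c.
    by exists 1; rewrite scale1r.
  move=> V Phi bPhi; rewrite big_seq1 /= (linear_Z _ _ (bilinear_l 1 bPhi)).
  by rewrite -(cosum_1 hopf bPhi) -(linear_Z _ _ (cosum_linear hopf bPhi)).
have sub1C z : (exists c, z = c *: 1) -> C z.
  by move=> [c ->]; rewrite -[_ *: _]addr0; apply: CL.
have [|] := Csimple _ sub1 sub1C.
- by move=> /(_ 1 (ex_intro _ 1 (esym (scale1r 1)))) /eqP; rewrite oner_eq0.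
- move=> /(_ y Cy) [c ->].
  rewrite (linear_Z _ _ lR) (scalar_Z sh) h1 /right_slice (cosum_1 hopf); last by lin.
  by rewrite h1 scale1r mulr1.
Qed.

End Haar.

(* [y_1 (x) x y_2 = S(x_1) x_2 y_1 (x) x_3 y_2] *)
Lemma antipode_shift (V : lmodType F) (Phi : H -> H -> V) x y : bilinear_map Phi ->
  cop (fun a b => Phi a (x * b)) y = cop (fun a b => cop (fun u v => Phi (S a * u) v) (b * y)) x.
Proof.
move=> bPhi; have lS := antipode_linear hopf; have le := eps_scalar hopf.
transitivity (cop (fun a b => cop (fun c d => cop (fun e f => Phi (S a * (c * e)) (d * f)) y) b) x);
  last first.
  by apply: eq_cosum => a b; rewrite [RHS](cosum_mul hopf) //; lin.
rewrite -(cosum_coassoc hopf (g := fun a c d => cop (fun e f => Phi (S a * (c * e)) (d * f)) y)); last by lin.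
transitivity (cop (fun a b => cop (fun e f => Phi e ((eps a *: b) * f)) y) x).
  rewrite cosum_exchange; apply: eq_cosum => e f.
  rewrite -(@cosum_out _ _ Delta H V (fun z => Phi e (z * f))); last by lin.
  by rewrite (counitl hopf).
apply: eq_cosum => a b; rewrite cosum_exchange; apply: eq_cosum => e f.
transitivity (Phi (eps a *: e) (b * f)).
  by rewrite -scalerAl (linear_Z _ _ (bilinear_r e bPhi)) (linear_Z _ _ (bilinear_l _ bPhi)).
rewrite -[eps a *: e]mul1r -scalerAr scalerAl -(antipodel hopf) -cosum_mulr.
rewrite (@cosum_out _ _ Delta H V (fun z => Phi z (b * f))); last by lin.
by apply: eq_cosum => c d; rewrite mulrA.
Qed.

(** By [antipode_shift] the left side is S(x_1) (x_2 y)_1 h((x_2 y)_2), and invariance collapses the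
    last two factors to h(x_2 y). *)
Lemma haar_antipode h x y : scalar h -> (forall x, rslice h x = h x *: 1) ->
  cop (fun a b => h (x * b) *: a) y = cop (fun a b => h (b * y) *: S a) x.
Proof.
move=> sh hinv; rewrite (antipode_shift (Phi := fun a b => h b *: a)); last by lin.
apply: eq_cosum => a b; rewrite -[S a in RHS]mulr1 scalerAr -hinv /right_slice -cosum_mull.
by apply: eq_cosum => u v; rewrite -scalerAr.
Qed.

End Hopf.

(** * Modules over a finite-dimensional algebra *)

Lemma lfun_of_linear (F : fieldType) (U V : vectType F) (f : U -> V) : linear f ->
  exists L : 'Hom(U, V), forall u, L u = f u.
Proof.
move=> lf; pose g : {linear U -> V} := HB.pack f (GRing.isLinear.Build F U V _ f lf).
by exists (linfun g) => u; rewrite lfunE.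
Qed.

Section Submodules.
Variables (F : fieldType) (V : vectType F) (I : Type) (T : I -> V -> V).
Hypothesis linT : forall i, linear (T i).
Implicit Types U X Y Z R : {vspace V}.

Lemma dim_minimal (P : {vspace V} -> Prop) U : P U ->
  exists X, P X /\ forall Y, P Y -> (\dim X <= \dim Y)%N.
Proof.
move=> PU; pose Q d := `[< exists X, P X /\ \dim X = d >].
have exQ : exists d, Q d by exists (\dim U); apply/asboolP; exists U.
case: (ex_minnP exQ) => d /asboolP [X [PX <-]] dmin.
by exists X; split=> // Y PY; apply: dmin; apply/asboolP; exists Y.
Qed.

Lemma dim_maximal (P : {vspace V} -> Prop) U : P U ->
  exists X, P X /\ forall Y, P Y -> (\dim Y <= \dim X)%N.
Proof.
move=> PU; pose Q d := `[< exists X, P X /\ \dim X = d >].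
have exQ : exists d, Q d by exists (\dim U); apply/asboolP; exists U.
have Qb d : Q d -> (d <= \dim (fullv : {vspace V}))%N.
  by move=> /asboolP [X [_ <-]]; exact: dimvS (subvf X).
case: (ex_maxnP exQ Qb) => d /asboolP [X [PX <-]] dmax.
by exists X; split=> // Y PY; apply: dmax; apply/asboolP; exists Y.
Qed.

Definition stable U := forall i v, v \in U -> T i v \in U.

Definition maximal_submodule X := [/\ stable X, X <> fullv &
  forall Y, stable Y -> (X <= Y)%VS -> Y = X \/ Y = fullv].

Lemma stableD U Z : stable U -> stable Z -> stable (U + Z).
Proof.
move=> sU sZ i _ /memv_addP [u Uu [z Zz ->]].
rewrite -[u]scale1r linT scale1r; apply: memv_add; [exact: sU|exact: sZ].
Qed.

Lemma stableI U Z : stable U -> stable Z -> stable (U :&: Z).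
Proof.
by move=> sU sZ i v; rewrite !memv_cap => /andP [Uv Zv]; rewrite sU ?sZ.
Qed.

Lemma maximal_submodule_above U : stable U -> U <> fullv ->
  exists X, maximal_submodule X /\ (U <= X)%VS.
Proof.
move=> sU Uf.
have [|X [[sX Xf UX] Xmax]] := @dim_maximal (fun X => [/\ stable X, X <> fullv & (U <= X)%VS]) U.
  by split.
exists X; split=> //; split=> // Y sY XY.
have [->|Yf] := EM (Y = fullv); [by right|left].
apply/esym/eqP; rewrite eqEdim XY Xmax //; split=> //; exact: subv_trans XY.
Qed.

(** Take [Z] of least dimension with U + Z = V. If a maximal [X] did not contain the intersection of
    [U] and [Z], the modular law would give V as the sum of [U] and the intersection of [Z] with
    [X], so [Z] would lie in [X]. *)
Lemma complement_modulo_radical U : stable U -> exists Z,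
  [/\ stable Z, (U + Z)%VS = fullv &
      forall X, maximal_submodule X -> (U :&: Z <= X)%VS].
Proof.
move=> sU.
have [|Z [[sZ UZ] Zmin]] := @dim_minimal (fun Z => stable Z /\ (U + Z)%VS = fullv) fullv.
  by split=> [i v _|]; [exact: memvf|exact: addvf].
exists Z; split=> // X [sX Xf Xmax]; apply: contrapT => UZX.
have XUZ : (X + (U :&: Z))%VS = fullv.
  case: (Xmax (X + (U :&: Z))%VS) => //; first by apply: stableD => //; exact: stableI.
    exact: addvSl.
  by move=> e; case: UZX; rewrite -e; exact: addvSr.
have UZ' : (U + (Z :&: X))%VS = fullv.
  apply/eqP; rewrite eqEsubv subvf /= -{1}UZ subv_add addvSl /=; apply/subvP => z Zz.
  have : z \in (X + (U :&: Z))%VS by rewrite XUZ memvf.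
  move=> /memv_addP [x Xx [w]]; rewrite memv_cap => /andP [Uw Zw] zE.
  rewrite zE addrC; apply: memv_add => //; rewrite memv_cap Xx andbT.
  by rewrite -[x](addrK w) -zE; exact: rpredB.
have ZX : (Z :&: X)%VS = Z.
  apply/eqP; rewrite eqEdim capvSl; apply: Zmin; split=> //; exact: stableI.
by apply: UZX; apply: subv_trans (capvSr _ _) _; rewrite -ZX; exact: capvSr.
Qed.

(** The family of maximal submodules may be infinite; a stable space of least dimension containing
    their intersection must lie inside each of them. *)
Lemma radical_exists : exists R, [/\ stable R,
   forall X, maximal_submodule X -> (R <= X)%VS &
   forall v, (forall X, maximal_submodule X -> v \in X) -> v \in R].
Proof.
have [|R [[sR Rv] Rmin]] := @dim_minimal (fun R => stable R /\
     forall v, (forall X, maximal_submodule X -> v \in X) -> v \in R) fullv.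
  by split=> [i v _|v _]; exact: memvf.
exists R; split=> // X mX; have [sX _ _] := mX.
have <- : (R :&: X)%VS = R; last exact: capvSr.
apply/eqP; rewrite eqEdim capvSl; apply: Rmin; split; first exact: stableI.
by move=> v hv; rewrite memv_cap Rv // hv.
Qed.

(** V / X is realized by subtracting the projection on [X] and reading the result in a basis of the
    image; [rho] is read off on lifts of the basis rows. *)
Lemma quotient_map X : stable X -> exists q (f : 'Hom(V, 'rV[F]_q)) (rho : I -> 'M[F]_q),
  [/\ forall v, f v = 0 <-> v \in X, forall r, exists v, f v = r &
      forall i v, f (T i v) = f v *m rho i].
Proof.
move=> sX.
pose f0 : 'End(V) := (\1 - projv X)%VF.
have f0E v : f0 v = v - projv X v by rewrite add_lfunE opp_lfunE id_lfunE.
have f0X v : f0 v = 0 <-> v \in X.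
  rewrite f0E; split; last by move=> Xv; rewrite projv_id // subrr.
  by move=> /eqP; rewrite subr_eq0 => /eqP ->; exact: memv_proj.
pose W := limg f0; pose b := vbasis W.
have bW : basis_of W b by exact: vbasisP.
have [|f fE] := @lfun_of_linear F V 'rV[F]_(\dim W) (fun v => \row_j coord b j (f0 v)).
  by move=> k u v; apply/rowP => j; rewrite !mxE !linearP.
have f0W v : f0 v \in W by exact: memv_img (memvf v).
have fX v : f v = 0 <-> v \in X.
  rewrite -f0X fE; split=> [e|->]; last by apply/rowP => j; rewrite !mxE linear0.
  rewrite (coord_basis bW (f0W v)) big1 // => j _.
  by move/rowP: e => /(_ j); rewrite !mxE => ->; rewrite scale0r.
have fsurj r : exists v, f v = r.
  have : \sum_j r 0 j *: b`_j \in W.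
    apply: rpred_sum => j _; apply: rpredZ; apply: vbasis_mem; apply: mem_nth.
    by rewrite size_tuple.
  move=> /memv_imgP [v _ e]; exists v; rewrite fE; apply/rowP => j; rewrite mxE -e.
  by rewrite coord_sum_free // (basis_free bW).
have [g gE] := choice (fun j => fsurj (delta_mx 0 j)).
exists (\dim W), f, (fun i => \matrix_(j, k) f (T i (g j)) 0 k); split=> // i v.
pose w := \sum_j f v 0 j *: g j.
have vw : v - w \in X.
  apply/fX; rewrite linearB /= /w linear_sum /=.
  under [X in _ - X]eq_bigr => j _ do rewrite linearZ /= gE.
  by rewrite -row_sum_delta subrr.
have -> : T i v = T i (v - w) + \sum_j f v 0 j *: T i (g j).
  by rewrite (linear_B _ _ (linT i)) /w (linear_sumZ _ _ _ _ (linT i)) subrK.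
rewrite linearD /= (proj2 (fX (T i (v - w)))) ?add0r; last exact: sX.
rewrite linear_sum /=; apply/rowP => k; rewrite summxE mxE; apply: eq_bigr => j _.
by rewrite linearZ !mxE.
Qed.

End Submodules.

(** * Modules given by matrices, and a criterion for generation by t elements *)

Section Representations.
Variables (F : fieldType) (n : nat) (c : 'I_n -> 'I_n -> 'I_n -> F) (o : 'I_n -> F).

(* [c] and [o] are the structure constants and the unit of an algebra with basis
   [e_0, .., e_(n-1)]; row vectors form a left module, [e_i] acting by [v |-> v *m T i]. *)
Definition is_rep q (T : 'I_n -> 'M[F]_q) :=
  (forall i k, T k *m T i = \sum_l c i k l *: T l) /\ \sum_l o l *: T l = 1%:M.

Definition simple_rep q (T : 'I_n -> 'M[F]_q) := (0 < q)%N /\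
  forall U : {vspace 'rV[F]_q}, stable (fun i v => v *m T i) U -> U = 0%VS \/ U = fullv.

Definition hom_space m q (T : 'I_n -> 'M[F]_m) (rho : 'I_n -> 'M[F]_q) : {vspace 'M[F]_(m, q)} :=
  (\bigcap_i lker (linfun (mulmx (T i)) - linfun (mulmxr (rho i))))%VS.

Lemma hom_spaceP m q (T : 'I_n -> 'M[F]_m) (rho : 'I_n -> 'M[F]_q) e :
  reflect (forall i, T i *m e = e *m rho i) (e \in hom_space T rho).
Proof.
rewrite memvE; apply: (iffP subv_bigcapP) => h i.
  have := h i isT; rewrite -memvE memv_ker add_lfunE opp_lfunE !lfunE /= subr_eq0.
  by move=> /eqP.
by move=> _; rewrite -memvE memv_ker add_lfunE opp_lfunE !lfunE /= h subrr.
Qed.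

(** The element sum_j y_j g_j of the s-fold power of [T], one row per copy; row j of [a] holds the
    coordinates of y_j in the algebra. *)
Definition combine s m t (T : 'I_n -> 'M[F]_m) (g : 'I_t -> 'M[F]_(s, m))
    (a : 'M[F]_(t, n)) : 'M[F]_(s, m) := \sum_j \sum_i a j i *: (g j *m T i).

Lemma combine_linear s m t (T : 'I_n -> 'M[F]_m) (g : 'I_t -> 'M[F]_(s, m)) :
  linear (combine T g).
Proof.
move=> k a b; rewrite /combine scaler_sumr -big_split; apply: eq_bigr => j _ /=.
rewrite scaler_sumr -big_split; apply: eq_bigr => i _ /=.
by rewrite !mxE scalerDl scalerA.
Qed.

(** Left multiplication by e_i on t-tuples of algebra elements. *)
Definition shift t (i : 'I_n) (a : 'M[F]_(t, n)) : 'M[F]_(t, n) :=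
  \matrix_(j, l) \sum_k a j k * c i k l.

Lemma combine_shift s m t (T : 'I_n -> 'M[F]_m) (g : 'I_t -> 'M[F]_(s, m)) i a :
  is_rep T -> combine T g a *m T i = combine T g (shift i a).
Proof.
move=> [Tm _]; rewrite /combine mulmx_suml; apply: eq_bigr => j _.
rewrite mulmx_suml.
under eq_bigr => k _ do rewrite -scalemxAl -mulmxA Tm mulmx_sumr scaler_sumr.
rewrite exchange_big; apply: eq_bigr => l _ /=; rewrite mxE scaler_suml.
by apply: eq_bigr => k _; rewrite -scalemxAr scalerA.
Qed.

Definition unit_row t (j : 'I_t) : 'M[F]_(t, n) := \matrix_(j', l) (if j' == j then o l else 0).

Lemma combine_unit s m t (T : 'I_n -> 'M[F]_m) (g : 'I_t -> 'M[F]_(s, m)) j :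
  is_rep T -> combine T g (unit_row j) = g j.
Proof.
move=> [_ T1]; rewrite /combine (bigD1 j) //= [X in _ + X]big1 ?addr0; last first.
  by move=> j' j'j; rewrite big1 // => i _; rewrite mxE (negPf j'j) scale0r.
under eq_bigr => i _ do rewrite mxE eqxx scalemxAr.
by rewrite -mulmx_sumr T1 mulmx1.
Qed.

Lemma combineD s m t (T : 'I_n -> 'M[F]_m) (g g' : 'I_t -> 'M[F]_(s, m)) a :
  combine T (fun j => g j + g' j) a = combine T g a + combine T g' a.
Proof.
rewrite /combine -big_split; apply: eq_bigr => j _ /=; rewrite -big_split.
by apply: eq_bigr => i _; rewrite mulmxDl scalerDr.
Qed.

Section Generation.
Variables (m s t : nat) (T : 'I_n -> 'M[F]_m).
Hypothesis repT : is_rep T.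
Let act i (X : 'M[F]_(s, m)) := X *m T i.

Let linact i : linear (act i).
Proof. by move=> k X Y; rewrite /act mulmxDl scalemxAl. Qed.

Lemma combine_equivariant q (rho : 'I_n -> 'M[F]_q)
    (f : 'Hom('M[F]_(s, m), 'rV[F]_q)) (g : 'I_t -> 'M[F]_(s, m)) a :
  (forall i X, f (X *m T i) = f X *m rho i) ->
  f (combine T g a) = combine rho (fun j => f (g j)) a.
Proof.
move=> fh; rewrite /combine linear_sum; apply: eq_bigr => j _ /=.
by rewrite linear_sum; apply: eq_bigr => i _ /=; rewrite linearZ /= fh.
Qed.

(* Homomorphisms out of the [s]-fold sum of [T] are [s]-tuples of elements of [hom_space]. *)
Lemma hom_from_power q (rho : 'I_n -> 'M[F]_q) (f : 'Hom('M[F]_(s, m), 'rV[F]_q)) :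
  (forall i X, f (X *m T i) = f X *m rho i) ->
  exists x : 'M[F]_(\dim (hom_space T rho), s), forall X,
    f X = \sum_b \sum_r x b r *: (row r X *m (vbasis (hom_space T rho))`_b).
Proof.
move=> fh; pose e r := \matrix_(k < m) f (delta_mx r k).
have eE r (v : 'rV_m) : v *m e r = f (delta_mx r 0 *m v).
  rewrite {2}(row_sum_delta v) mulmx_sumr linear_sum /= mulmx_sum_row.
  by apply: eq_bigr => k _; rewrite rowK -scalemxAr linearZ /= mul_delta_mx.
have eh r : e r \in hom_space T rho.
  apply/hom_spaceP => i; apply/row_matrixP => k; rewrite !row_mul eE rowK -fh.
  by rewrite rowE mulmxA mul_delta_mx.
exists (\matrix_(b, r) coord (vbasis (hom_space T rho)) b (e r)) => X.
transitivity (\sum_r row r X *m e r).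
  under eq_bigr => r _ do rewrite eE.
  rewrite -linear_sum /=; congr (f _); rewrite [LHS]matrix_sum_delta.
  apply: eq_bigr => r _; rewrite [row r X]row_sum_delta mulmx_sumr; apply: eq_bigr => k _.
  by rewrite -scalemxAr mul_delta_mx mxE.
rewrite exchange_big; apply: eq_bigr => r _ /=.
rewrite {1}(coord_vbasis (eh r)) mulmx_sumr; apply: eq_bigr => b _.
by rewrite mxE scalemxAr.
Qed.

Lemma simple_quotient q (f : 'Hom('M[F]_(s, m), 'rV[F]_q)) (rho : 'I_n -> 'M[F]_q) X :
  maximal_submodule act X -> (forall v, f v = 0 <-> v \in X) ->
  (forall r, exists v, f v = r) -> (forall i v, f (v *m T i) = f v *m rho i) ->
  is_rep rho /\ simple_rep rho.
Proof.
move=> [sX Xf Xmax] fX fs fh; have [Tm T1] := repT.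
have rowext (A B : 'M[F]_q) : (forall v, f v *m A = f v *m B) -> A = B.
  move=> AB; apply/row_matrixP => j; rewrite !rowE; have [v <-] := fs (delta_mx 0 j).
  exact: AB.
split; first split.
- move=> i k; apply: rowext => v; rewrite mulmxA -!fh -mulmxA Tm mulmx_sumr mulmx_sumr.
  by rewrite linear_sum /=; apply: eq_bigr => l _; rewrite -!scalemxAr linearZ /= fh.
- apply: rowext => v; rewrite mulmx1 -[v in RHS]mulmx1 -T1 !mulmx_sumr linear_sum.
  by apply: eq_bigr => l _; rewrite -!scalemxAr linearZ /= fh.
split.
  case: (posnP q) => // q0; case: Xf; apply/vspaceP => v; rewrite memvf; apply/fX.
  by apply/rowP => -[k kq]; exfalso; move: kq; rewrite q0.
move=> U sU; case: (Xmax (f @^-1: U)%VS).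
- by move=> i v; rewrite -!memv_preim fh; exact: sU.
- by apply/subvP => v /fX fv; rewrite -memv_preim fv mem0v.
- move=> e; left; apply/eqP; rewrite -subv0; apply/subvP => r Ur.
  have [v fv] := fs r; rewrite memv0 -fv; apply/eqP/fX.
  by rewrite -e -memv_preim fv.
- move=> e; right; apply/vspaceP => r; rewrite memvf; have [v <-] := fs r.
  by rewrite memv_preim e memvf.
Qed.

(** [K g] holds the relations among the [g j] modulo the radical [R], and [g] is chosen to make it
    smallest. If the [g j] generated a proper [U], a simple quotient [f] killing [U] would allow a
    perturbation of [g] without new relations; minimality then produces a homomorphism with values
    chosen to be unattainable. *)
Lemma generation :
  (forall q (rho : 'I_n -> 'M[F]_q), is_rep rho -> simple_rep rho ->
     (\dim (hom_space T rho) * s <= t * q)%N) ->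
  exists g : 'I_t -> 'M[F]_(s, m), forall X, exists a, X = combine T g a.
Proof.
move=> homle.
have [R [sR Rmax maxR]] := radical_exists act.
have [G GE] := choice (fun g : 'I_t -> 'M[F]_(s, m) => lfun_of_linear (combine_linear T g)).
pose K g := (G g @^-1: R)%VS.
have KE g a : (a \in K g) = (combine T g a \in R) by rewrite -memv_preim GE.
have [_ [[g ->] gmin]] := @dim_minimal _ _ (fun W => exists g, W = K g) (K (fun=> 0))
  (ex_intro _ _ erefl).
exists g => X0; pose U := limg (G g).
have UP a : combine T g a \in U by rewrite -GE memv_img ?memvf.
have Uex X : X \in U -> exists a, X = combine T g a.
  by move=> /memv_imgP [a _ ->]; exists a; rewrite GE.
apply: (Uex X0); suff -> : U = fullv by exact: memvf.
apply: contrapT => Uf.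
have sU : stable act U.
  by move=> i _ /Uex [a ->]; rewrite /act combine_shift.
have [X [mX UX]] := maximal_submodule_above sU Uf; have [sX Xf Xmax] := mX.
have [q [f [rho [fX fs fh]]]] := quotient_map linact sX.
have [repr simr] := simple_quotient mX fX fs fh.
have [Y [sY XY XYmax]] := complement_modulo_radical linact sX.
have [Z [sZ UZ UZmax]] := complement_modulo_radical linact sU.
set d := \dim (hom_space T rho) in homle *.
(* [Psi] evaluates at the [g j] the homomorphisms from the power to [rho], given by d s scalars. It
   kills the parameter [x0] of [f], so d s <= t q prevents it from being onto. *)
pose theta (x : 'M[F]_(d, s)) (N : 'M[F]_(s, m)) : 'rV[F]_q :=
  \sum_b \sum_r x b r *: (row r N *m (vbasis (hom_space T rho))`_b).
have [|Psi PsiE] := @lfun_of_linear F 'M[F]_(d, s) 'M[F]_(t, q)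
    (fun x => \matrix_j theta x (g j)).
  move=> k x y; apply/row_matrixP => j; rewrite linearP /= !rowK /theta.
  rewrite scaler_sumr -big_split; apply: eq_bigr => b _ /=.
  rewrite scaler_sumr -big_split; apply: eq_bigr => r _ /=.
  by rewrite !mxE scalerDl scalerA.
have [x0 x0E] := hom_from_power fh.
have x0n : x0 != 0.
  apply/eqP => x00; apply: Xf; apply/vspaceP => v; rewrite memvf; apply/fX.
  by rewrite x0E x00 big1 // => b _; rewrite big1 // => r _; rewrite mxE scale0r.
have gU j : g j \in U by rewrite -(combine_unit g j repT).
have Psix0 : Psi x0 = 0.
  rewrite PsiE; apply/row_matrixP => j; rewrite rowK row0 /theta -x0E; apply/fX.
  exact: (subvP UX).
have [phi phiN] : exists phi, phi \notin limg Psi.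
  apply: contrapT => /forallNP nphi.
  have fullP : limg Psi = fullv.
    by apply/vspaceP => p; rewrite memvf; have /negP := nphi p; rewrite negbK.
  have := limg_ker_dim Psi fullv; rewrite capfv -/(limg Psi) fullP !dimvf /= /dim /=.
  have : (0 < \dim (lker Psi))%N.
    rewrite lt0n dimv_eq0; apply/eqP => k0; move/eqP: x0n; apply; apply/eqP.
    by rewrite -memv0 -k0 memv_ker Psix0.
  have := homle q rho repr simr; rewrite -/d.
  lia.
(* The missed value [phi] is lifted through [f] into [Y]. Since [X] meets [Y] inside [R], adding the
   lifts to [g] creates no relation modulo [R]. *)
have /choice [psi psiP] : forall j, exists y, y \in Y /\ f y = row j phi.
  move=> j; have [v fv] := fs (row j phi).
  have : v \in (X + Y)%VS by rewrite XY memvf.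
  move=> /memv_addP [x Xx [y Yy vE]]; exists y; split=> //.
  by rewrite -fv vE linearD /= (proj2 (fX x) Xx) add0r.
pose g' j := g j + psi j.
have psiY a : combine T psi a \in Y.
  apply: rpred_sum => j _; apply: rpred_sum => i _; apply: rpredZ; apply: sY.
  by case: (psiP j).
have K'R a : a \in K g' -> combine T psi a \in R.
  rewrite KE combineD => Ra; apply: maxR => X' mX'.
  apply: (subvP (XYmax X' mX')); rewrite memv_cap psiY andbT.
  rewrite -[combine T psi a](addKr (combine T g a)); apply: rpredD.
    by rewrite rpredN; exact: (subvP UX).
  exact: (subvP (Rmax X mX)).
have K'K : (K g' <= K g)%VS.
  apply/subvP => a Ka; have := K'R a Ka; move: Ka; rewrite !KE combineD => Ra Rpsi.
  by rewrite -[combine T g a](addrK (combine T psi a)) rpredB.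
have KK' : K g' = K g by apply/eqP; rewrite eqEdim K'K gmin //; exists g'.
pose phit a := combine rho (fun j => row j phi) a.
have phitE a : phit a = f (combine T psi a).
  by rewrite (combine_equivariant psi a fh) /phit /combine; apply: eq_bigr => j _;
    rewrite (proj2 (psiP j)).
have Kphi a : combine T g a \in R -> phit a = 0.
  rewrite -KE -KK' => /K'R Rpsi; rewrite phitE; apply/fX.
  exact: (subvP (Rmax X mX)).
pose Ginv := ((G g)^-1)%VF.
(* [th] sends [combine T g a] + z, with z in [Z], to [phit a]. This is well defined because [U]
   meets [Z] inside [R], where [Kphi] applies. It takes the values [phi] at [g], against the choice
   of [phi]. *)
have [|th thE] := @lfun_of_linear F 'M[F]_(s, m) 'rV[F]_q
    (fun N => phit (Ginv (addv_pi1 U Z N))).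
  by move=> k N N'; rewrite !linearP; exact: combine_linear.
have thP a z : z \in Z -> th (combine T g a + z) = phit a.
  move=> Zz; rewrite thE; set N := _ + z; set b := Ginv _.
  have bE : combine T g b = addv_pi1 U Z N.
    rewrite -GE /b /Ginv limg_lfunVK //=.
    exact: memv_pi1.
  have NE : combine T g b + addv_pi2 U Z N = N.
    by rewrite bE addv_pi1_pi2 // UZ memvf.
  have abU : combine T g (b - a) \in (U :&: Z)%VS.
    rewrite memv_cap UP /= (linear_B _ _ (combine_linear T g)).
    have -> : combine T g b - combine T g a = z - addv_pi2 U Z N.
      rewrite -[combine T g b](addrK (addv_pi2 U Z N)) NE addrAC.
      by rewrite /N (addrC _ z) addrK.
    by rewrite rpredB // memv_pi2.
  have /eqP : phit (b - a) = 0.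
    by apply: Kphi; apply: maxR => X' mX'; apply: (subvP (UZmax X' mX')).
  by rewrite /phit (linear_B _ _ (combine_linear rho _)) subr_eq0 => /eqP.
have thh i N : th (N *m T i) = th N *m rho i.
  have : N \in (U + Z)%VS by rewrite UZ memvf.
  move=> /memv_addP [u /Uex [a ->] [z Zz ->]].
  rewrite mulmxDl combine_shift // !thP //; last exact: sZ.
  by rewrite /phit combine_shift.
have [x xE] := hom_from_power thh.
move/negP: phiN; apply; apply/memv_imgP; exists x; first exact: memvf.
rewrite PsiE; apply/row_matrixP => j; rewrite rowK /theta -xE.
rewrite -(combine_unit g j repT) -[combine _ _ _]addr0 thP ?mem0v //.
by rewrite /phit combine_unit.
Qed.

End Generation.

(** A nonzero homomorphism to a simple module is onto, so q <= m as soon as the ratio is positive.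
    Hence m! clears all denominators, and the resulting integers are at most m m!, because dim Hom
    <= m q. *)
Lemma best_simple_rep m (T : 'I_n -> 'M[F]_m) q0 (rho0 : 'I_n -> 'M[F]_q0) :
  is_rep rho0 -> simple_rep rho0 -> (0 < \dim (hom_space T rho0))%N ->
  exists q (rho : 'I_n -> 'M[F]_q), [/\ is_rep rho, simple_rep rho,
    (0 < \dim (hom_space T rho))%N &
    forall q' (rho' : 'I_n -> 'M[F]_q'), is_rep rho' -> simple_rep rho' ->
      (\dim (hom_space T rho') * q <= \dim (hom_space T rho) * q')%N].
Proof.
move=> rep0 sim0 hom0.
have qm q (rho : 'I_n -> 'M[F]_q) : simple_rep rho -> (0 < \dim (hom_space T rho))%N ->
    (q <= m)%N.
  move=> [q0' sim] d0; pose e := vpick (hom_space T rho).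
  have /hom_spaceP eh : e \in hom_space T rho by exact: memv_pick.
  have e0 : e != 0 by rewrite vpick0 -dimv_eq0 -lt0n.
  pose L := linfun (mulmxr e : 'rV[F]_m -> 'rV[F]_q).
  have [||LU] := sim (limg L).
  - move=> i _ /memv_imgP [v _ ->]; rewrite lfunE /= -mulmxA -eh mulmxA.
    have -> : v *m T i *m e = L (v *m T i) by rewrite lfunE.
    exact: memv_img (memvf _).
  - move=> L0; case/negP: e0; apply/eqP/row_matrixP => k; rewrite row0 rowE.
    apply/eqP; rewrite -memv0 -L0.
    have -> : delta_mx 0 k *m e = L (delta_mx 0 k) by rewrite lfunE.
    exact: memv_img (memvf _).
  - have := limg_ker_dim L fullv; rewrite -/(limg L) LU !dimvf /= /dim /= !mul1n.
    lia.
pose P v := `[< exists q (rho : 'I_n -> 'M[F]_q), [/\ is_rep rho, simple_rep rho,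
    (0 < \dim (hom_space T rho))%N & v = (\dim (hom_space T rho) * (m`! %/ q))%N] >].
have exP : exists v, P v.
  by exists (\dim (hom_space T rho0) * (m`! %/ q0))%N; apply/asboolP; exists q0, rho0.
have Pb v : P v -> (v <= m * m`!)%N.
  move=> /asboolP [q [rho [rep sim d0 ->]]].
  have qd : (q %| m`!)%N by apply: dvdn_fact; rewrite (qm _ _ sim d0) andbT; case: sim.
  rewrite -[X in (_ <= _ * X)%N](divnK qd) mulnA [X in (_ <= X)%N]mulnAC leq_mul2r.
  apply/orP; right; have := dimvS (subvf (hom_space T rho)).
  by rewrite dimvf.
case: (ex_maxnP exP Pb) => v /asboolP [q [rho [rep sim d0 vE]]] vmax.
exists q, rho; split=> // q' rho' rep' sim'.
have [->|d0'] := posnP (\dim (hom_space T rho')); first by rewrite mul0n.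
have := vmax _ (asboolT (ex_intro _ q' (ex_intro _ rho' (And4 rep' sim' d0' erefl)))).
rewrite vE => le.
have q_gt0 : (0 < q)%N by case: sim.
have q'_gt0 : (0 < q')%N by case: sim'.
have qd : (q %| m`!)%N by apply: dvdn_fact; rewrite q_gt0 (qm _ _ sim d0).
have qd' : (q' %| m`!)%N by apply: dvdn_fact; rewrite q'_gt0 (qm _ _ sim' d0').
rewrite -(leq_pmul2r (fact_gt0 m)).
have -> : (\dim (hom_space T rho') * q * m`! =
  \dim (hom_space T rho') * (m`! %/ q') * (q * q'))%N by rewrite -{1}(divnK qd'); lia.
have -> : (\dim (hom_space T rho) * q' * m`! =
  \dim (hom_space T rho) * (m`! %/ q) * (q * q'))%N by rewrite -{1}(divnK qd); lia.
by rewrite leq_mul2r le orbT.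
Qed.

End Representations.

(** * Weak finiteness *)

Lemma weakly_finite_indexed (F : fieldType) (H : algType F) (I : finType) (X Y : I -> I -> H) :
  weakly_finite H -> (forall i k, \sum_j X i j * Y j k = (i == k)%:R) ->
  forall i k, \sum_j Y i j * X j k = (i == k)%:R.
Proof.
move=> wf XY i k.
pose A := \matrix_(i < #|I|, j < #|I|) X (enum_val i) (enum_val j).
pose B := \matrix_(i < #|I|, j < #|I|) Y (enum_val i) (enum_val j).
have sumE (f : I -> H) : \sum_(j < #|I|) f (enum_val j) = \sum_j f j.
  by rewrite [RHS](reindex _ (onW_bij _ (@enum_val_bij I))).
have AB : A *m B = 1%:M.
  apply/matrixP => a b; rewrite !mxE -(inj_eq enum_val_inj) -XY -sumE.
  by apply: eq_bigr => j _; rewrite !mxE.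
have := congr1 (fun M : 'M_#|I| => M (enum_rank i) (enum_rank k)) (wf _ _ _ AB).
rewrite !mxE (inj_eq enum_rank_inj) => <-; rewrite -sumE.
by apply: eq_bigr => j _; rewrite !mxE !enum_rankK.
Qed.

Section WeaklyFinite.
Variables (F : fieldType) (H : algType F).
Local Notation "M ^A" := (map_mx (in_alg H) M) (at level 8, format "M ^A") : ring_scope.

Lemma alg_scale_mx p q r (M : 'M[F]_(p, q)) (a : H) (N : 'M[H]_(q, r)) :
  M^A *m (a *: N) = a *: (M^A *m N).
Proof.
apply/matrixP => i j; rewrite !mxE mulr_sumr; apply: eq_bigr => k _; rewrite !mxE /=.
by rewrite -!scalerAl !mul1r scalerAr.
Qed.

Variables (n m q t : nat) (T : 'I_n -> 'M[F]_m) (rho : 'I_n -> 'M[F]_q).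
Variables (u : 'I_n -> 'I_n -> H) (Z Zl : 'M[H]_m).
Hypothesis ZlZ : Zl *m Z = 1%:M.
Hypothesis TZ : forall i, \sum_x u i x *: (Z *m (T x)^A) = (T i)^A *m Z.
Variables (e dual : 'I_t -> 'M[F]_(m, q)) (g : 'I_t -> 'M[F]_(q, m)).
Hypothesis eT : forall b l, T l *m e b = e b *m rho l.
Hypothesis e_dual : forall b b', \sum_k \sum_l dual b k l * e b' k l = (b == b')%:R.
Hypothesis g_gen : forall X, exists a, X = combine T g a.

(** With [Z] the matrix of Delta on I, row (j, l) and column (b, r) hold the coordinate l of (id (x)
    e_b) Delta applied to the r-th component of g_j. *)
Let G (jl br : 'I_t * 'I_q) : H := ((g jl.1)^A *m Z *m (e br.1)^A) br.2 jl.2.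
Let coef (a : 'M[F]_(t, n)) l (jl : 'I_t * 'I_q) : H :=
  \sum_i \sum_x (a jl.1 i * rho x jl.2 l) *: u i x.

(** [TZ] expresses that Delta is multiplicative and [eT] that [e b] is a module map, so an algebra
    coefficient y_j acts on the rows of [G] through (id (x) rho) Delta(y_j), whose entries are
    [coef]. *)
Let coef_combine a b r l :
  ((combine T g a)^A *m Z *m (e b)^A) r l = \sum_jl coef a l jl * G jl (b, r).
Proof.
have -> : (combine T g a)^A *m Z *m (e b)^A = \sum_j \sum_i \sum_x
    (a j i *: u i x) *: ((g j)^A *m Z *m (e b)^A *m (rho x)^A).
  rewrite /combine raddf_sum !mulmx_suml; apply: eq_bigr => j _.
  rewrite raddf_sum !mulmx_suml; apply: eq_bigr => i _ /=.
  rewrite map_mxZ map_mxM -!scalemxAl -[_ *m _ *m Z]mulmxA -TZ mulmx_sumr mulmx_suml scaler_sumr.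
  apply: eq_bigr => x _.
  rewrite alg_scale_mx -scalemxAl scalerA -scalerAl mul1r; congr (_ *: _).
  by rewrite -!mulmxA -!map_mxM eT.
rewrite -(pair_bigA _ (fun j l' => coef a l (j, l') * G (j, l') (b, r))) summxE.
apply: eq_bigr => j _; rewrite summxE.
transitivity (\sum_i \sum_x \sum_l' ((a j i * rho x l' l) *: u i x) * G (j, l') (b, r)).
  apply: eq_bigr => i _; rewrite summxE; apply: eq_bigr => x _.
  rewrite mxE [X in _ * X]mxE mulr_sumr.
  apply: eq_bigr => l' _; rewrite [X in _ * (_ * X)]mxE /= -!scalerAr mulr1.
  by rewrite -!scalerAl scalerA mulrC.
transitivity (\sum_i \sum_l' \sum_x ((a j i * rho x l' l) *: u i x) * G (j, l') (b, r)).
  by apply: eq_bigr => i _; rewrite exchange_big.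
rewrite exchange_big; apply: eq_bigr => l' _ /=; rewrite mulr_suml.
by apply: eq_bigr => i _; rewrite mulr_suml.
Qed.

(* [G] is square because the generators are as many as the homomorphisms [e] and
   the power is the dimension [q] of the target; [g_gen] provides a left inverse. *)
Lemma relation_coefficients : weakly_finite H -> forall a : 'M[F]_(t, n),
  combine T g a = 0 -> forall j l' l, \sum_i \sum_x (a j i * rho x l' l) *: u i x = 0.
Proof.
move=> wf; have [al alE] := choice (fun rk : 'I_q * 'I_m => g_gen (delta_mx rk.1 rk.2)).
(* [X b] writes a unit vector in the rows of [G]: [al] expands matrix units in the generators, [Zl]
   undoes Delta, and [dual] isolates one homomorphism. *)
pose X (br jl : 'I_t * 'I_q) : H := \sum_k' \sum_l'' dual br.1 k' l'' *:
  \sum_k Zl k' k * coef (al (br.2, k)) l'' jl.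
have XG b r : \sum_jl X b jl * G jl r = (b == r)%:R.
  case: b r => [b0 r0] [b r].
  transitivity (\sum_k' \sum_l'' dual b0 k' l'' *: \sum_k Zl k' k *
      ((delta_mx r0 k)^A *m Z *m (e b)^A) r l'').
    rewrite /X; under eq_bigr => jl _ do rewrite mulr_suml.
    rewrite exchange_big; apply: eq_bigr => k' _ /=.
    under eq_bigr => jl _ do rewrite mulr_suml.
    rewrite exchange_big; apply: eq_bigr => l'' _ /=.
    under eq_bigr => jl _ do rewrite -scalerAl.
    rewrite -scaler_sumr; congr (_ *: _).
    transitivity (\sum_jl \sum_k Zl k' k * coef (al (r0, k)) l'' jl * G jl (b, r)).
      by apply: eq_bigr => jl _; rewrite mulr_suml.
    rewrite exchange_big; apply: eq_bigr => k _ /=.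
    rewrite (alE (r0, k)) coef_combine mulr_sumr.
    by apply: eq_bigr => jl _; rewrite mulrA.
  transitivity (\sum_k' \sum_l'' (dual b0 k' l'' * e b k' l'') *: ((r == r0)%:R : H)).
    apply: eq_bigr => k' _; apply: eq_bigr => l'' _; rewrite -scalerA; congr (_ *: _).
    transitivity ((r == r0)%:R * (Zl *m (Z *m (e b)^A)) k' l'').
      rewrite mxE mulr_sumr; apply: eq_bigr => k _.
      rewrite map_delta_mx -mulmxA.
      have -> : (delta_mx r0 k *m (Z *m (e b)^A)) r l'' = (r == r0)%:R * (Z *m (e b)^A) k l''.
        rewrite mxE (bigD1 k) //= mxE eqxx andbT big1 ?addr0 // => k1 /negPf k1k.
        by rewrite mxE k1k andbF mul0r.
      by case: (r == r0); rewrite ?mul1r // !mul0r mulr0.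
    by rewrite mulmxA ZlZ mul1mx mxE /= -scalerAr mulr1.
  under eq_bigr => k' _ do rewrite -scaler_suml.
  rewrite -scaler_suml e_dual xpair_eqE (eq_sym r).
  by case: (b0 == b); rewrite ?scale1r ?scale0r.
have GX := weakly_finite_indexed wf XG.
move=> a a0 j l' l; rewrite -/(coef a l (j, l')).
have aG br : \sum_jl coef a l jl * G jl br = 0.
  by case: br => b r; rewrite -coef_combine a0 map_mx0 !mul0mx mxE.
transitivity (\sum_br (\sum_jl coef a l jl * G jl br) * X br (j, l')); last first.
  by rewrite big1 // => br _; rewrite aG mul0r.
under eq_bigr => br _ do rewrite mulr_suml.
rewrite exchange_big /= (bigD1 (j, l')) //= [X in _ + X]big1 ?addr0.
  under eq_bigr => br _ do rewrite -mulrA.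
  by rewrite -mulr_sumr GX eqxx mulr1.
move=> jl /negPf jlN; under eq_bigr => br _ do rewrite -mulrA.
by rewrite -mulr_sumr GX jlN mulr0.
Qed.

End WeaklyFinite.

(** * Nondegeneracy of the Haar functional *)

Section MoreSlices.
Variables (F : fieldType) (H : algType F).
Variables (Delta : H -> seq (H * H)) (eps : H -> F) (S : H -> H).
Hypothesis hopf : is_hopf Delta eps S.
Local Notation cop := (cosum Delta).
Local Notation lslice := (left_slice Delta).
Local Notation rslice := (right_slice Delta).
Local Notation costable := (costable Delta).

Lemma eps_rslice phi x : scalar phi -> eps (rslice phi x) = phi x.
Proof.
move=> sphi; rewrite scalar_rslice; last exact: eps_scalar hopf.
rewrite -{2}(counitl hopf x) (@cosum_out _ _ _ H F^o phi) //.
by apply: (@eq_cosum F H Delta F^o) => a b; rewrite scalar_Z // mulrC.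
Qed.

Lemma lslice_eps x : lslice eps x = x. Proof. exact: counitl hopf x. Qed.

Lemma lslice_lslice phi psi x : scalar phi -> scalar psi ->
  lslice phi (lslice psi x) = lslice (fun y => psi (rslice phi y)) x.
Proof.
move=> sp sq; have ll := lslice_linear hopf sp.
transitivity (cop (fun a b => lslice phi (psi a *: b)) x); first exact: cosum_out.
transitivity (cop (fun a b => cop (fun c d => psi a *: (phi c *: d)) b) x).
  by apply: eq_cosum => a b; rewrite cosum_scale (linear_Z _ _ ll).
rewrite -(cosum_coassoc hopf (g := fun a c d => psi a *: (phi c *: d))); last by lin.
apply: eq_cosum => a b; rewrite scalar_rslice //.
rewrite -(cosum_scalar Delta (fun c d => phi d * psi c)).
by apply: eq_cosum => c d; rewrite scalerA mulrC.
Qed.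

Lemma lslice_mull A n a xi phi (x y : H) : @coordinates F H A n a xi -> costable A -> A x ->
  scalar phi ->
  lslice phi (x * y) = \sum_l a l * lslice (fun v => phi (rslice (xi l) x * v)) y.
Proof.
move=> cA sA Ax sp; rewrite {1}/left_slice (cosum_mul hopf); last by lin.
rewrite (cosum_expand (Phi := fun a b => cop (fun c d => phi (a * c) *: (b * d)) y) cA sA Ax).
  apply: eq_bigr => l _; rewrite /left_slice -cosum_mull; apply: eq_cosum => c d.
  by rewrite -scalerAr.
lin.
Qed.

Lemma lslice_mulr A n a xi phi (x y : H) : @coordinates F H A n a xi -> costable A -> A y ->
  scalar phi ->
  lslice phi (x * y) = \sum_l lslice (fun v => phi (v * rslice (xi l) y)) x * a l.
Proof.
move=> cA sA Ay sp; rewrite {1}/left_slice (cosum_mul hopf); last by lin.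
rewrite cosum_exchange.
rewrite (cosum_expand (Phi := fun c d => cop (fun a b => phi (a * c) *: (b * d)) x) cA sA Ay).
  apply: eq_bigr => l _; rewrite /left_slice -cosum_mulr; apply: eq_cosum => c d.
  by rewrite -scalerAl.
lin.
Qed.

Lemma rslice_mul A n a xi A' n' a' xi' lam (x y : H) : @coordinates F H A n a xi -> costable A -> A x ->
  @coordinates F H A' n' a' xi' -> costable A' -> A' y -> scalar lam ->
  rslice lam (x * y) = \sum_i \sum_j lam (a i * a' j) *: (rslice (xi i) x * rslice (xi' j) y).
Proof.
move=> cA sA Ax cA' sA' A'y sl; rewrite {1}/right_slice (cosum_mul hopf); last by lin.
rewrite (cosum_expand (Phi := fun a b => cop (fun c d => lam (b * d) *: (a * c)) y) cA sA Ax).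
  apply: eq_bigr => i _.
  by rewrite (cosum_expand (Phi := fun c d => lam (a i * d) *: (rslice (xi i) x * c)) cA' sA' A'y) //; lin.
lin.
Qed.

(** In Sweedler form S(x_1) x_2 lam(x_3) = lam(x) 1. On a basis and its dual it says that applying S
    to the entries of the matrix of Delta gives a left inverse. *)
Lemma rslice_antipode A n a xi lam (x : H) : @coordinates F H A n a xi -> costable A -> A x ->
  scalar lam -> \sum_i S (rslice (xi i) x) * rslice lam (a i) = lam x *: 1.
Proof.
move=> cA sA Ax sl; have lS := antipode_linear hopf.
have lr := rslice_linear hopf sl; have le := eps_scalar hopf.
rewrite -(cosum_expand (Phi := fun a b => S a * rslice lam b) cA sA Ax); last by lin.
transitivity (cop (fun a b => cop (fun c d => lam d *: (S a * c)) b) x).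
  apply: eq_cosum => b d; rewrite /right_slice -cosum_mull; apply: eq_cosum => e f.
  by rewrite -scalerAr.
rewrite -(cosum_coassoc hopf (g := fun a c d => lam d *: (S a * c))); last by lin.
transitivity (cop (fun b d => (lam d * eps b) *: (1 : H)) x).
  by apply: eq_cosum => b d; rewrite cosum_scale (antipodel hopf) scalerA.
by rewrite (cosum_scalar Delta (fun c d => lam d * eps c)) -scalar_rslice // eps_rslice.
Qed.

End MoreSlices.

Section Nondegenerate.
Variables (F : fieldType) (H : algType F).
Variables (Delta : H -> seq (H * H)) (eps : H -> F) (S : H -> H).
Hypothesis hopf : is_hopf Delta eps S.
Hypothesis wf : weakly_finite H.
Variable h : H -> F.
Hypothesis sh : scalar h.
Hypothesis h1 : h 1 = 1.
Hypothesis hinv : forall x, right_slice Delta h x = h x *: 1.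
Local Notation cop := (cosum Delta).
Local Notation lslice := (left_slice Delta).
Local Notation rslice := (right_slice Delta).
Local Notation costable := (costable Delta).

Variables (A : H -> Prop) (n : nat) (a : 'I_n -> H) (xi : 'I_n -> H -> F).
Hypothesis sA : lin_subspace A.
Hypothesis A1 : A 1.
Hypothesis AM : forall x y, A x -> A y -> A (x * y).
Hypothesis cA : costable A.
Hypothesis aA : coordinates A a xi.

Let le := eps_scalar hopf.

Definition costable_ideal (I : H -> Prop) := [/\ lin_subspace I, forall x, I x -> A x,
  forall x y, A x -> I y -> I (x * y) & costable I].

Let rad y := A y /\ forall x, A x -> h (x * y) = 0.

Let rad_ideal : costable_ideal rad.
Proof.
have lS := antipode_linear hopf.
split.
- split; first by split; [case: sA|move=> x _; rewrite mulr0 scalar_0].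
  move=> c x y [Ax hx] [Ay hy]; split; first by case: sA => _; exact.
  by move=> z Az; rewrite mulrDr -scalerAr sh hx // hy // mulr0 addr0.
- by move=> x [].
- move=> x y Ax [Ay hy]; split; first exact: AM.
  by move=> z Az; rewrite mulrA hy //; exact: AM.
(* Here phi(x_1) h(z x_2) = phi(S(z_1)) h(z_2 x), and the slice phi(S(z_1)) z_2 is again in [A]. *)
- move=> phi sp x [Ax hx]; split; first exact: cA.
  move=> z Az.
  transitivity (phi (cop (fun c d => h (z * d) *: c) x)).
    rewrite (@cosum_out _ _ _ H F^o phi) //.
    rewrite /left_slice -cosum_mull (@cosum_out _ _ _ H F^o h) //.
    apply: (@eq_cosum F H Delta F^o) => c d.
    by rewrite -scalerAr !scalar_Z // mulrC.
  rewrite (haar_antipode hopf z x sh hinv) (@cosum_out _ _ _ H F^o phi) //.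
  transitivity (h (lslice (fun v => phi (S v)) z * x)).
    rewrite /left_slice -cosum_mulr (@cosum_out _ _ _ H F^o h) //.
    apply: (@eq_cosum F H Delta F^o) => c d.
    by rewrite -scalerAl !scalar_Z // mulrC.
  by apply: hx; apply: cA => //; lin.
Qed.

Let a_span x : A x -> x = \sum_i xi i x *: a i. Proof. by case: aA => _ _ _; exact. Qed.
Let Aa i : A (a i). Proof. by case: aA. Qed.
Let sxi i : scalar (xi i). Proof. by case: aA. Qed.

Let c i k l := xi l (a i * a k).
Let o l := xi l 1.

Section MinimalIdeal.
Variables (I : H -> Prop) (m : nat) (b : 'I_m -> H) (eta : 'I_m -> H -> F).
Hypothesis idI : costable_ideal I.
Hypothesis bI : coordinates I b eta.
Hypothesis I_neq0 : exists x, I x /\ x <> 0.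
Hypothesis Imin : forall J, costable_ideal J -> (forall x, J x -> I x) ->
  (exists x, J x /\ x <> 0) -> forall x, I x -> J x.

Let b_span x : I x -> x = \sum_i eta i x *: b i. Proof. by case: bI => _ _ _; exact. Qed.
Let Ib i : I (b i). Proof. by case: bI. Qed.
Let seta i : scalar (eta i). Proof. by case: bI. Qed.
Let IM x y : A x -> I y -> I (x * y). Proof. by case: idI => _ _ + _; exact. Qed.
Let cI : costable I. Proof. by case: idI. Qed.
Let sI : lin_subspace I. Proof. by case: idI. Qed.

Let T i : 'M[F]_m := \matrix_(k, j) eta j (a i * b k).

Let repT : is_rep c o T.
Proof.
split.
- move=> i k; apply/matrixP => r j; rewrite !mxE summxE.
  transitivity (eta j (a i * (a k * b r))).
    rewrite (b_span (IM (Aa k) (Ib r))) mulr_sumr.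
    under [in RHS]eq_bigr => p _ do rewrite -scalerAr.
    by rewrite scalar_sumZ //; apply: eq_bigr => p _; rewrite !mxE.
  rewrite mulrA (a_span (AM (Aa i) (Aa k))) mulr_suml.
  under [in LHS]eq_bigr => p _ do rewrite -scalerAl.
  by rewrite scalar_sumZ //; apply: eq_bigr => p _; rewrite !mxE.
- apply/matrixP => r j; rewrite summxE mxE.
  have [_ _ e _] := bI; rewrite eq_sym -e -[b r]mul1r (a_span A1) mulr_suml.
  under [in RHS]eq_bigr => p _ do rewrite -scalerAl.
  by rewrite scalar_sumZ //; apply: eq_bigr => p _; rewrite !mxE.
Qed.

Let rho0 i : 'M[F]_1 := const_mx (eps (a i)).

Let rep0 : is_rep c o rho0.
Proof.
split.
- move=> i k; apply/matrixP => r j; rewrite mxE big_ord1 summxE !mxE mulrC.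
  rewrite -(eps_mul hopf) (a_span (AM (Aa i) (Aa k))) scalar_sumZ //.
  by apply: eq_bigr => p _; rewrite !mxE.
- apply/matrixP => r j; rewrite summxE mxE !ord1 eqxx -(eps_1 hopf) (a_span A1).
  by rewrite scalar_sumZ //; apply: eq_bigr => p _; rewrite !mxE.
Qed.

Let sim0 : simple_rep rho0.
Proof.
split=> // U _; have := dimvS (subvf U); rewrite dimvf /dim /= => dU.
have [d0|dn0] := posnP (\dim U); first by left; apply/eqP; rewrite -dimv_eq0 d0.
right; apply/eqP; rewrite eqEdim subvf dimvf /dim /=.
by move: dU dn0; case: (\dim U) => [|[]].
Qed.

Let eps_neq0 : exists x, I x /\ eps x != 0.
Proof.
apply: contrapT => /forallNP ne; have [x [Ix]] := I_neq0; apply.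
apply: (separated_costable hopf cI) Ix => y Iy; apply/eqP; apply: contrapT => /negP ny.
by apply: (ne y).
Qed.

(** The counit restricted to [I] is a nonzero homomorphism to the trivial module. *)
Let hom0 : (0 < \dim (hom_space T rho0))%N.
Proof.
rewrite lt0n dimv_eq0; apply/eqP => h0.
pose e0 : 'M[F]_(m, 1) := \matrix_(k, l) eps (b k).
have : e0 \in hom_space T rho0.
  apply/hom_spaceP => i; apply/matrixP => k l; rewrite !mxE big_ord1 !mxE mulrC.
  rewrite -(eps_mul hopf) (b_span (IM (Aa i) (Ib k))) scalar_sumZ //.
  by apply: eq_bigr => p _; rewrite !mxE.
rewrite h0 memv0 => /eqP e00; have [x [Ix]] := eps_neq0; rewrite (b_span Ix) scalar_sumZ //.
rewrite big1 ?eqxx // => k _; move/matrixP: e00 => /(_ k 0); rewrite !mxE => ->.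
by rewrite mulr0.
Qed.

Section SimpleModule.
Variables (q : nat) (rho : 'I_n -> 'M[F]_q).
Hypothesis hom_pos : (0 < \dim (hom_space T rho))%N.

Let rhof p r (x : H) : F := \sum_l xi l x * rho l p r.
Let srhof p r : scalar (rhof p r).
Proof. by rewrite /rhof; apply: sca_sum => l; apply: sca_mulr. Qed.

Let ev (e : 'M[F]_(m, q)) (x : H) : 'rV[F]_q := (\row_k eta k x) *m e.
Let ev_linear e : linear (ev e).
Proof.
move=> k x y; rewrite /ev scalemxAl -mulmxDl; congr (_ *m _).
by apply/rowP => j; rewrite !mxE seta.
Qed.

Let ev_b e k : ev e (b k) = row k e.
Proof.
rewrite /ev rowE; congr (_ *m _); apply/rowP => j; rewrite !mxE eqxx /=.
by case: bI => _ _ -> _.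
Qed.

Let ev_mul e x y : e \in hom_space T rho -> A x -> I y ->
  ev e (x * y) = ev e y *m \sum_l xi l x *: rho l.
Proof.
move=> /hom_spaceP eh Ax Iy.
rewrite {1}(a_span Ax) mulr_suml mulmx_sumr.
under eq_bigr => l _ do rewrite -scalerAl.
rewrite (linear_sumZ _ _ _ _ (ev_linear e)); apply: eq_bigr => l _.
rewrite -scalemxAr; congr (_ *: _); rewrite /ev -mulmxA -eh mulmxA; congr (_ *m _).
apply/rowP => j; rewrite !mxE {1}(b_span Iy) mulr_sumr.
under eq_bigr => k _ do rewrite -scalerAr.
by rewrite scalar_sumZ //; apply: eq_bigr => k _; rewrite !mxE.
Qed.

(** The y with (id (x) rho) Delta(y) = 0, the condition that [relation_coefficients] delivers. *)
Let N y := A y /\ forall p r, rslice (rhof p r) y = 0.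

(* The largest costable left ideal inside the common kernel of all homomorphisms from [I]. *)
Let Ker y := I y /\ forall phi e, scalar phi -> e \in hom_space T rho -> ev e (lslice phi y) = 0.

(** Otherwise minimality makes [Ker] all of [I], and every homomorphism from [I] to [rho] vanishes,
    against [hom_pos]. *)
Let Ker0 y : Ker y -> y = 0.
Proof.
move=> Ky; apply: contrapT => y0.
have idK : costable_ideal Ker.
  split.
  - split.
      split; first by case: sI.
      by move=> phi e sp _; rewrite (linear_0 (lslice_linear hopf sp)) (linear_0 (ev_linear e)).
    move=> k u v [Iu Ku] [Iv Kv]; split; first by case: sI => _; exact.
    move=> phi e sp eh; rewrite (lslice_linear hopf sp) (ev_linear e) Ku // Kv //.
    by rewrite scaler0 addr0.
  - by move=> x [Ix _]; case: idI => _ IA _ _; exact: IA.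
  - move=> x z Ax [Iz Kz]; split; first exact: IM.
    move=> phi e sp eh; rewrite (lslice_mull hopf _ aA) //.
    rewrite (linear_sumE _ _ _ (ev_linear e)) big1 // => l _.
    have sl : scalar (fun v => phi (rslice (xi l) x * v)) by lin.
    by rewrite ev_mul // ?Kz ?mul0mx //; exact: cI.
  - move=> psi sp x [Ix Kx]; split; first exact: cI.
    move=> phi e sphi eh; rewrite (lslice_lslice hopf) // Kx //.
    by have lr := rslice_linear hopf sphi; lin.
have KI := Imin idK (fun x Kx => proj1 Kx) (ex_intro _ y (conj Ky y0)).
have : vpick (hom_space T rho) == 0.
  apply/eqP/row_matrixP => k; rewrite row0 -ev_b -[b k](lslice_eps hopf).
  by case: (KI _ (Ib k)) => _; apply => //; exact: memv_pick.
by rewrite vpick0 -dimv_eq0 => /eqP d0; move: hom_pos; rewrite d0.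
Qed.

(** As [N] is costable, it suffices that eps vanishes on it. For z in [I] with eps(z) nonzero, y z
    lies in [Ker], so it is 0 and eps(y) eps(z) = 0. *)
Let N0 y : N y -> y = 0.
Proof.
move=> Ny.
have cN : costable N.
  move=> phi sp x [Ax Nx]; split; first exact: cA.
  move=> p r; rewrite (rslice_lslice hopf) // Nx.
  exact: linear_0 (lslice_linear hopf sp).
apply: (separated_costable hopf cN) Ny => {}y [Ay Ny].
have [z [Iz ez]] := eps_neq0.
have : y * z = 0.
  apply: Ker0; split; first exact: IM.
  move=> phi e sp eh; rewrite (lslice_mulr hopf _ bI) //.
  rewrite (linear_sumE _ _ _ (ev_linear e)) big1 // => l _.
  set psi := fun v => _.
  have sl : scalar psi by rewrite /psi; lin.
  rewrite ev_mul //; last exact: cA.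
  suff -> : \sum_l xi l (lslice psi y) *: rho l = 0 by rewrite mulmx0.
  apply/matrixP => p r; rewrite summxE mxE.
  transitivity (rhof p r (lslice psi y)); first by apply: eq_bigr => k _; rewrite mxE.
  have [_ Nl] := cN psi sl y (conj Ay Ny).
  by rewrite -(eps_rslice hopf) // Nl scalar_0.
move=> /(congr1 eps); rewrite (eps_mul hopf) scalar_0 // => /eqP.
by rewrite mulf_eq0 (negPf ez) orbF => /eqP.
Qed.

Lemma relations_trivial (g : 'I_(\dim (hom_space T rho)) -> 'M[F]_(q, m)) :
  (forall X, exists al, X = combine T g al) -> forall al, combine T g al = 0 -> al = 0.
Proof.
move=> ggen al al0.
(* [u] and [Z] are the matrices of Delta on [A] and on [I]; the antipode supplies the left inverse
   [Zl]. *)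
pose u i x := rslice (xi x) (a i).
pose Z := \matrix_(k, p) rslice (eta p) (b k).
pose Zl := \matrix_(k, p) S (rslice (eta p) (b k)).
have ZlZ : Zl *m Z = 1%:M.
  apply/matrixP => i j; rewrite !mxE.
  under eq_bigr => p _ do rewrite !mxE.
  rewrite (rslice_antipode hopf bI cI) //; have [_ _ e _] := bI.
  by rewrite e eq_sym; case: (_ == _); rewrite ?scale1r ?scale0r.
have TZ i : \sum_x u i x *: (Z *m map_mx (in_alg H) (T x)) = map_mx (in_alg H) (T i) *m Z.
  apply/matrixP => k j; rewrite summxE !mxE.
  transitivity (rslice (eta j) (a i * b k)).
    rewrite (rslice_mul hopf aA cA (Aa i) bI cI (Ib k)) //.
    apply: eq_bigr => x _; rewrite !mxE mulr_sumr; apply: eq_bigr => p _.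
    by rewrite !mxE /= -!scalerAr mulr1.
  have lr := rslice_linear hopf (seta j).
  rewrite (b_span (IM (Aa i) (Ib k))) (linear_sumZ _ _ _ _ lr).
  by apply: eq_bigr => p _; rewrite !mxE /= -scalerAl mul1r.
pose vb := vbasis (hom_space T rho).
pose e (i : 'I_(\dim (hom_space T rho))) : 'M[F]_(m, q) := vb`_i.
pose dual i : 'M[F]_(m, q) := \matrix_(k, l) coord vb i (delta_mx k l).
have vbB : basis_of (hom_space T rho) vb by exact: vbasisP.
have eT i l : T l *m e i = e i *m rho l.
  have : e i \in hom_space T rho.
    by apply: vbasis_mem; apply: mem_nth; rewrite size_tuple.
  by move=> /hom_spaceP.
have e_dual i j : \sum_k \sum_l dual i k l * e j k l = (i == j)%:R.
  transitivity (coord vb i (e j)); last by rewrite coord_free ?(basis_free vbB) // eq_sym.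
  rewrite [e j in RHS]matrix_sum_delta.
  rewrite linear_sum; apply: eq_bigr => k _ /=; rewrite linear_sum; apply: eq_bigr => l _ /=.
  by rewrite linearZ /= mxE mulrC.
have rel := relation_coefficients ZlZ TZ eT e_dual ggen wf al0.
apply/matrixP => j i; rewrite mxE.
have xiE : xi i (\sum_i al j i *: a i) = al j i.
  rewrite scalar_sumZ // (bigD1 i) //= big1 ?addr0; first by case: aA => _ _ -> _; rewrite eqxx mulr1.
  by move=> l /negPf li; case: aA => _ _ -> _; rewrite eq_sym li mulr0.
rewrite -xiE [X in xi i X]N0 ?scalar_0 //; split; first exact: subspace_sum.
move=> p r; rewrite (linear_sumZ _ _ _ _ (rslice_linear hopf (srhof p r))).
rewrite -[RHS](rel j p r); apply: eq_bigr => k _.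
rewrite /right_slice /cosum /u scaler_sumr.
under [in RHS]eq_bigr => x _ do rewrite /right_slice /cosum scaler_sumr.
rewrite [RHS]exchange_big; apply: eq_bigr => w _ /=.
rewrite /rhof scaler_suml scaler_sumr; apply: eq_bigr => x _.
by rewrite !scalerA; congr (_ *: _); rewrite -!mulrA; congr (_ * _); rewrite mulrC.
Qed.

End SimpleModule.

Lemma minimal_ideal_dim : (n <= m)%N.
Proof.
have [q [rho [rep sim hom_pos best]]] := best_simple_rep rep0 sim0 hom0.
have q_gt0 : (0 < q)%N by case: sim.
have qt : (q <= \dim (hom_space T rho))%N.
  have := best _ _ rep0 sim0; rewrite muln1; apply: leq_trans.
  by rewrite -{1}[q]mul1n leq_mul2r hom0 orbT.
have [g ggen] := generation (s := q) (t := \dim (hom_space T rho)) repT best.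
have inj := relations_trivial hom_pos ggen.
have [G GE] := lfun_of_linear (combine_linear T g).
have K0 : lker G = 0%VS.
  apply/eqP; rewrite -subv0; apply/subvP => al; rewrite memv_ker GE memv0 => /eqP /inj ->.
  exact: eqxx.
have := limg_ker_dim G fullv; rewrite K0 capv0 dimv0 add0n => dimG.
have := dimvS (subvf (limg G)); rewrite dimG !dimvf /dim /= => le1.
have : (\dim (hom_space T rho) * n <= \dim (hom_space T rho) * m)%N.
  by apply: leq_trans le1 _; rewrite leq_mul2r qt orbT.
by rewrite leq_pmul2l.
Qed.

End MinimalIdeal.

Lemma haar_nondegenerate y : A y -> (forall x, A x -> h (x * y) = 0) -> y = 0.
Proof.
move=> Ay hy; apply: contrapT => y0.
have spanA (J : H -> Prop) : costable_ideal J -> forall x, J x -> in_span a x.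
  by move=> [_ JA _ _] x /JA Ax; exists (xi^~ x); exact: a_span.
pose good J := [/\ costable_ideal J, forall x, J x -> rad x & exists x, J x /\ x <> 0].
pose P d := `[< exists J b eta, good J /\ @coordinates F H J d b eta >].
have exP : exists d, P d.
  have [sr _ _ _] := rad_ideal.
  have [d [b [eta bE]]] := coordinates_exist sr (spanA _ rad_ideal).
  exists d; apply/asboolP; exists rad, b, eta; split=> //.
  by split=> //; exists y.
case: (ex_minnP exP) => m /asboolP [I [b [eta [[idI Irad In0] bI]]]] mmin.
have [sI IA _ _] := idI.
have Imin J : costable_ideal J -> (forall x, J x -> I x) ->
    (exists x, J x /\ x <> 0) -> forall x, I x -> J x.
  move=> idJ JI Jn0; have [sJ _ _ _] := idJ.
  have [d [b' [eta' bJ]]] := coordinates_exist sJ (spanA _ idJ).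
  apply: (coordinates_eq sJ bI bJ) => //; apply: mmin; apply/asboolP.
  by exists J, b', eta'; split=> //; split=> // x /JI /Irad.
have nm := minimal_ideal_dim idI bI In0 Imin.
have AI := coordinates_eq sI aA bI nm IA.
have [_ /(_ 1 A1)] := Irad _ (AI _ A1).
by rewrite mulr1 h1 => /eqP; rewrite oner_eq0.
Qed.

Let B := \matrix_(i, j) h (a i * a j).

Let hB (w v : 'I_n -> F) :
  h ((\sum_i w i *: a i) * (\sum_j v j *: a j)) = \sum_i \sum_j w i * v j * B i j.
Proof.
rewrite mulr_suml scalar_sumE //; apply: eq_bigr => i _.
rewrite mulr_sumr scalar_sumE //; apply: eq_bigr => j _.
by rewrite -scalerAl -scalerAr !scalar_Z // mxE mulrA.
Qed.

(** [haar_nondegenerate] kills the kernel of the Gram matrix on one side; since the matrix is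
    square, the other side and the representability of functionals follow. *)
Let B_unit : B \in unitmx.
Proof.
rewrite -unitmx_tr -row_free_unit -kermx_eq0; apply/eqP/row_matrixP => k.
rewrite row0; set v := row k _.
have vB : v *m B^T = 0 by apply/sub_kermxP; exact: row_sub.
have y0 : \sum_j v 0 j *: a j = 0.
  apply: haar_nondegenerate; first exact: subspace_sum.
  move=> x /a_span ->; rewrite hB big1 // => i _.
  move/rowP: vB => /(_ i); rewrite !mxE => e.
  rewrite -[RHS](mulr0 (xi i x)) -[X in _ * X]e mulr_sumr; apply: eq_bigr => j _.
  by rewrite !mxE mulrA.
apply/rowP => j; rewrite [RHS]mxE.
have := congr1 (xi j) y0; rewrite scalar_0 // scalar_sumZ // (bigD1 j) //= big1.
  by rewrite addr0; case: aA => _ _ -> _; rewrite eqxx mulr1.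
by move=> l /negPf lj; case: aA => _ _ -> _; rewrite eq_sym lj mulr0.
Qed.

Lemma haar_nondegenerate_left x : A x -> (forall y, A y -> h (x * y) = 0) -> x = 0.
Proof.
move=> Ax hx; pose w := \row_i xi i x.
have wB : w *m B = 0.
  apply/rowP => j; rewrite !mxE -[RHS](hx _ (Aa j)) {1}(a_span Ax) mulr_suml scalar_sumE //.
  by apply: eq_bigr => i _; rewrite !mxE -scalerAl scalar_Z.
have w0 : w = 0 by rewrite -[w](mulmxK B_unit) wB mul0mx.
rewrite (a_span Ax) big1 // => i _; move/rowP: w0 => /(_ i); rewrite !mxE => ->.
by rewrite scale0r.
Qed.

Lemma haar_represents_left lam : scalar lam ->
  exists x, A x /\ forall y, A y -> h (x * y) = lam y.
Proof.
move=> sl; pose w := (\row_j lam (a j)) *m invmx B.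
have wB : w *m B = \row_j lam (a j) by rewrite mulmxKV ?B_unit.
exists (\sum_i w 0 i *: a i); split; first exact: subspace_sum.
move=> y Ay; rewrite {1}(a_span Ay) hB {2}(a_span Ay) scalar_sumZ // exchange_big.
apply: eq_bigr => j _ /=; move/rowP: wB => /(_ j); rewrite !mxE => <-.
by rewrite mulr_sumr; apply: eq_bigr => i _; rewrite ?mxE mulrAC mulrC.
Qed.

Lemma haar_represents_right lam : scalar lam ->
  exists y, A y /\ forall x, A x -> h (x * y) = lam x.
Proof.
move=> sl; pose v := invmx B *m (\col_j lam (a j)).
have Bv : B *m v = \col_j lam (a j) by rewrite mulKVmx ?B_unit.
exists (\sum_i v i 0 *: a i); split; first exact: subspace_sum.
move=> x Ax; rewrite {1}(a_span Ax) hB {2}(a_span Ax) scalar_sumZ //.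
apply: eq_bigr => i _ /=; move/colP: Bv => /(_ i); rewrite !mxE => <-.
by rewrite mulr_sumr; apply: eq_bigr => j _; rewrite mxE -mulrA; congr (_ * _); rewrite mulrC.
Qed.

End Nondegenerate.

(** * Integrals *)

Section LeftIntegrals.
Variables (F : fieldType) (H : algType F).
Variables (Delta : H -> seq (H * H)) (eps : H -> F) (S : H -> H).
Hypothesis hopf : is_hopf Delta eps S.
Hypothesis wf : weakly_finite H.
Variable h : H -> F.
Hypothesis sh : scalar h.
Hypothesis h1 : h 1 = 1.
Hypothesis hinv : forall x, right_slice Delta h x = h x *: 1.
Local Notation cop := (cosum Delta).
Local Notation lslice := (left_slice Delta).
Local Notation rslice := (right_slice Delta).
Local Notation costable := (costable Delta).

Section Subalgebra.
Variables (A : H -> Prop) (n : nat) (a : 'I_n -> H) (xi : 'I_n -> H -> F).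
Hypothesis sA : lin_subspace A.
Hypothesis A1 : A 1.
Hypothesis AM : forall x y, A x -> A y -> A (x * y).
Hypothesis cA : costable A.
Hypothesis aA : coordinates A a xi.

Let le := eps_scalar hopf.
Let lS := antipode_linear hopf.
Let Aa i : A (a i). Proof. by case: aA. Qed.
Let sxi i : scalar (xi i). Proof. by case: aA. Qed.

Lemma eq_cosum_in (V : lmodType F) (Phi Psi : H -> H -> V) x :
  bilinear_map Phi -> bilinear_map Psi -> (forall u v, A v -> Phi u v = Psi u v) ->
  A x -> cop Phi x = cop Psi x.
Proof.
move=> bPhi bPsi e Ax; rewrite !(cosum_expand aA) //.
by apply: eq_bigr => i _; exact: e.
Qed.

Lemma haar_sub_eq0 x y : A x -> A y -> (forall z, A z -> h (x * z) = h (y * z)) -> x = y.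
Proof.
move=> Ax Ay e; apply/eqP; rewrite -subr_eq0; apply/eqP.
apply: (haar_nondegenerate_left hopf wf sh h1 hinv sA A1 AM cA aA); first exact: subspaceB.
by move=> z Az; rewrite mulrBl scalar_B // e // subrr.
Qed.

Variable L : H.
Hypotheses (AL : A L) (L_neq0 : L <> 0).

Section LeftIntegral.
Hypothesis left_L : forall x, A x -> x * L = eps x *: L.

(** Since h(x L) = eps(x) h(L), a vanishing h(L) would put [L] in the radical. *)
Lemma haar_integral_neq0 : h L != 0.
Proof.
apply/eqP => hL; apply: L_neq0.
apply: (haar_nondegenerate hopf wf sh h1 hinv sA A1 AM cA aA) => // x Ax.
by rewrite left_L // scalar_Z // hL mulr0.
Qed.

Lemma antipode_formula x : A x -> h L *: S x = cop (fun u v => h (x * v) *: u) L.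
Proof.
move=> Ax; rewrite (haar_antipode hopf x L sh hinv).
transitivity (cop (fun u v => h L *: S (eps v *: u)) x).
  rewrite cosum_scale; congr (_ *: _).
  by rewrite -(@cosum_out _ _ Delta H H S) // (counitr hopf).
apply: eq_cosum_in => //; [by lin|by lin|] => u v Av.
by rewrite left_L // scalar_Z // linear_Z // scalerA mulrC.
Qed.

(** On [A] the functional [lam] is h(x -) for some x in [A], so [antipode_formula] computes the
    slice. Thus the first legs of Delta(L) lie in S(A). *)
Lemma rslice_integral lam : scalar lam ->
  exists x, [/\ A x, rslice lam L = h L *: S x & h L * eps x = lam L].
Proof.
move=> sl; have [x [Ax xE]] := haar_represents_left hopf wf sh h1 hinv sA A1 AM cA aA sl.
exists x; split=> //; last by rewrite -xE // left_L // scalar_Z // mulrC.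
rewrite antipode_formula //; apply: eq_cosum_in => //; [by lin|by lin|] => u v Av.
by rewrite xE.
Qed.

(** Applying [h] to the second leg gives L_1 h(L L_2) = h(L) L, while [antipode_formula] at [L]
    gives h(L) S(L). *)
Lemma antipode_fixes : teq [seq (p.1, L * p.2) | p <- Delta L] [:: (L, L)] -> S L = L.
Proof.
move=> /(_ H (fun u v => h v *: u)); rewrite big_map big_seq1 /= => e.
have bil : bilinear_map (fun u v : H => h v *: u) by lin.
have := antipode_formula AL; rewrite [RHS](e bil).
by move=> /(scalerI haar_integral_neq0).
Qed.

End LeftIntegral.

Section RightIntegral.
Hypothesis right_L : forall x, A x -> L * x = eps x *: L.

Lemma antipode_formula_right x : A x -> h L *: x = cop (fun u v => h (v * x) *: S u) L.
Proof.
move=> Ax; rewrite -(haar_antipode hopf L x sh hinv).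
rewrite -{1}(counitr hopf x) -cosum_scale.
apply: eq_cosum_in => //; [by lin|by lin|] => u v Av.
by rewrite right_L // scalar_Z // scalerA mulrC.
Qed.

Lemma right_integral_teq : teq [seq (p.1, L * p.2) | p <- Delta L] [:: (L, L)].
Proof.
move=> V Phi bPhi; rewrite big_map big_seq1 /=.
transitivity (cop (fun u v => Phi (eps v *: u) L) L); last first.
  by rewrite -(@cosum_out _ _ Delta H V (fun z => Phi z L)) ?(counitr hopf) //; lin.
apply: (@eq_cosum_in _ (fun u v => Phi u (L * v))) => //; [by lin|by lin|] => u v Av.
rewrite right_L // (linear_Z _ _ (bilinear_r u bPhi)).
by rewrite (linear_Z _ _ (bilinear_l L bPhi)).
Qed.

End RightIntegral.

(** Applied to x z, the hypothesis gives h(L x z) = eps(x) h(L z) for all z in [A]; nondegeneracy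
    removes [h]. *)
Lemma haar_right_integral :
  (forall x, A x -> h (L * x) = eps x * h L) -> forall x, A x -> L * x = eps x *: L.
Proof.
move=> hL x Ax; apply: haar_sub_eq0; [exact: AM|exact: subspaceZ|] => z Az.
rewrite -mulrA hL; last exact: AM.
by rewrite -scalerAl scalar_Z // hL // (eps_mul hopf) mulrA.
Qed.

(** The first legs of Delta(L) lie in S(A), and S(x) L = S(L x) = eps(x) L because S fixes [L] and
    reverses products; likewise on the other side. *)
Lemma two_sided_of_integral : (forall x, A x -> x * L = eps x *: L) ->
  (forall x, A x -> L * x = eps x *: L) -> S L = L ->
  teq [seq (p.1 * L, p.2) | p <- Delta L] [:: (L, L)] /\
  teq [seq (L * p.1, p.2) | p <- Delta L] [:: (L, L)].
Proof.
move=> left_L right_L SL.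
have finish (V : lmodType F) (Phi : H -> H -> V) (f : H -> H) : linear f ->
    (forall x, A x -> f (S x) = eps x *: L) -> bilinear_map Phi ->
    cop (fun u v => Phi (f u) v) L = Phi L L.
  move=> lf fS bPhi; rewrite (cosum_expand aA) //; last by lin.
  transitivity (\sum_i xi i L *: Phi L (a i)); last first.
    rewrite -(linear_sumZ _ _ _ _ (bilinear_r L bPhi)); congr (Phi L _).
    by case: aA => _ _ _ <-.
  apply: eq_bigr => i _; have [x [Ax -> <-]] := rslice_integral left_L (sxi i).
  by rewrite linear_Z // fS // scalerA (linear_Z _ _ (bilinear_l _ bPhi)).
split=> V Phi bPhi; rewrite big_map big_seq1 /=.
  apply: (finish _ _ (fun u => u * L)) => //; first by lin.
  by move=> x Ax; rewrite -{1}SL -(antipode_mul hopf) right_L // linear_Z // SL.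
apply: (finish _ _ (fun u => L * u)) => //; first by lin.
by move=> x Ax; rewrite -{1}SL -(antipode_mul hopf) left_L // linear_Z // SL.
Qed.

End Subalgebra.

(** * The left coideal subalgebra attached to an element of integral type *)

Section IntegralType.
Variable L : H.
Hypothesis intL : integral_type Delta L.

(** The smallest left coideal subalgebra containing [L]; in it [L] is a left integral, so the
    preceding results apply. *)
Definition integral_algebra (x : H) := exists k phi, scalar phi /\ x = k *: 1 + lslice phi L.

Let integralE (V : lmodType F) (Phi : H -> H -> V) : bilinear_map Phi ->
  cop (fun u v => Phi u (v * L)) L = Phi L L.
Proof. by move=> bPhi; case: intL => _ /(_ V Phi bPhi); rewrite big_map big_seq1. Qed.

Let lS := antipode_linear hopf.
Let le := eps_scalar hopf.

Lemma lslice_integral_mul phi : scalar phi -> lslice phi L * L = phi L *: L.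
Proof.
move=> sp; rewrite /left_slice -cosum_mulr.
rewrite -(integralE (Phi := fun u v => phi u *: v)); last by lin.
by apply: eq_cosum => u v; rewrite scalerAl.
Qed.

(** With w = phi(L_1) L_2 this is Delta(w)(1 (x) L) = w (x) L: apply Delta to the first leg of the
    integral identity, then [phi]. *)
Let integral_lslice (V : lmodType F) (Psi : H -> H -> V) phi : bilinear_map Psi -> scalar phi ->
  cop (fun u v => Psi u (v * L)) (lslice phi L) = Psi (lslice phi L) L.
Proof.
move=> bPsi sp; have lc : linear (cop (fun u v => Psi u (v * L))) by lin.
rewrite {1}/left_slice cosum_out //.
transitivity (cop (fun u v => cop (fun c d => phi u *: Psi c (d * L)) v) L).
  by apply: eq_cosum => u v; rewrite cosum_scale linear_Z.
rewrite -(cosum_coassoc hopf (g := fun u c d => phi u *: Psi c (d * L))); last by lin.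
rewrite (integralE (Phi := fun u w => cop (fun c d => phi c *: Psi d w) u)); last by lin.
rewrite /left_slice (@cosum_out _ _ Delta H V (fun z => Psi z L)); last by lin.
by apply: eq_cosum => u v; rewrite (linear_Z _ _ (bilinear_l L bPsi)).
Qed.

(** This gives closure under products. For w the first slice, [antipode_shift] rewrites psi(L_1) w
    L_2 as psi(S(w_1) (w_2 L)_1) (w_2 L)_2, and w_1 (x) w_2 L = w (x) L. *)
Lemma lslice_integral_lslice phi psi : scalar phi -> scalar psi ->
  lslice phi L * lslice psi L = lslice (fun v => psi (S (lslice phi L) * v)) L.
Proof.
move=> sp sq; rewrite {2}/left_slice -cosum_mull.
transitivity (cop (fun u v => psi u *: (lslice phi L * v)) L).
  by apply: eq_cosum => u v; rewrite scalerAr.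
rewrite (antipode_shift hopf (Phi := fun u v => psi u *: v)); last by lin.
rewrite (integral_lslice (Psi := fun u w => cop (fun c d => psi (S u * c) *: d) w)) //.
by lin.
Qed.

Lemma integral_algebraP : exists n a xi,
  [/\ lin_subspace integral_algebra, integral_algebra 1,
      forall x y, integral_algebra x -> integral_algebra y -> integral_algebra (x * y),
      costable integral_algebra & @coordinates F H integral_algebra n a xi].
Proof.
have s0 : scalar (fun _ : H => 0 : F) by move=> c x y; rewrite mulr0 addr0.
have lslice0 x : lslice (fun=> 0) x = 0.
  by rewrite /left_slice /cosum big1 // => p _; rewrite scale0r.
have lsliceD k phi psi x : k *: lslice phi x + lslice psi x = lslice (fun v => k * phi v + psi v) x.
  rewrite /left_slice /cosum scaler_sumr -big_split; apply: eq_bigr => p _ /=.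
  by rewrite scalerDl scalerA.
have scaD k (phi psi : H -> F) : scalar phi -> scalar psi -> scalar (fun v => k * phi v + psi v).
  move=> sp sq c x y; rewrite sp sq !mulrDr !mulrA (mulrC k c) addrACA.
  by rewrite -!mulrA.
have sub : lin_subspace integral_algebra.
  split; first by exists 0, (fun=> 0); rewrite scale0r lslice0 addr0.
  move=> c _ _ [k [phi [sp ->]]] [k' [psi [sq ->]]].
  exists (c * k + k'), (fun v => c * phi v + psi v); split; first exact: scaD.
  by rewrite -lsliceD scalerDl -scalerA scalerDr addrACA.
have A1 : integral_algebra 1 by exists 1, (fun=> 0); rewrite scale1r lslice0 addr0.
have Al phi : scalar phi -> integral_algebra (lslice phi L).
  by move=> sp; exists 0, phi; rewrite scale0r add0r.
have AM x y : integral_algebra x -> integral_algebra y -> integral_algebra (x * y).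
  move=> [k [phi [sp ->]]] Ay; rewrite mulrDl -scalerAl mul1r.
  apply: subspaceD => //; first exact: subspaceZ.
  case: Ay => [k' [psi [sq ->]]]; rewrite mulrDr -scalerAr mulr1.
  apply: subspaceD => //; first by apply: subspaceZ => //; exact: Al.
  by rewrite lslice_integral_lslice //; apply: Al; lin.
have cA : costable integral_algebra.
  move=> psi sq _ [k [phi [sp ->]]]; have ll := lslice_linear hopf sq.
  rewrite ll; apply: subspaceD => //.
    apply: subspaceZ => //; rewrite /left_slice (cosum_1 hopf); last by lin.
    exact: subspaceZ.
  rewrite (lslice_lslice hopf) //; apply: Al.
  by have lr := rslice_linear hopf sq; lin.
pose s (i : 'I_(size (Delta L)).+1) :=
  if unlift ord0 i is Some j then (tnth (in_tuple (Delta L)) j).2 else 1.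
have [|n [a [xi aA]]] := coordinates_exist (s := s) sub.
  move=> _ [k [phi [sp ->]]].
  exists (fun i => if unlift ord0 i is Some j then phi (tnth (in_tuple (Delta L)) j).1 else k).
  rewrite big_ord_recl /s unlift_none; congr (_ + _).
  rewrite /left_slice /cosum (big_tnth _ _ (Delta L)); apply: eq_bigr => j _.
  by rewrite liftK.
by exists n, a, xi.
Qed.

Lemma integral_algebra_mem : integral_algebra L.
Proof. by exists 0, eps; split=> //; rewrite scale0r add0r (lslice_eps hopf). Qed.

Lemma integral_algebra_left x : integral_algebra x -> x * L = eps x *: L.
Proof.
move=> [k [phi [sp ->]]]; rewrite mulrDl -scalerAl mul1r lslice_integral_mul //.
by rewrite -scalerDl le (eps_lslice hopf) // (eps_1 hopf) mulr1.
Qed.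

(** For a slice x = phi(L_1) L_2 one has h(L x) = phi(L_1 h(L L_2)) = h(L) phi(S(L)), which is h(L)
    eps(x) when S fixes [L]. *)
Lemma integral_algebra_right : S L = L -> forall x, integral_algebra x -> L * x = eps x *: L.
Proof.
move=> SL; have [n [a [xi [sA A1 AM cA aA]]]] := integral_algebraP.
have AL := integral_algebra_mem; have Ll := integral_algebra_left.
apply: (haar_right_integral sA A1 AM cA aA AL) => _ [k [phi [sp ->]]].
rewrite mulrDr -scalerAr mulr1 sh le (eps_1 hopf) (eps_lslice hopf) // mulr1 mulrDl.
congr (_ + _); rewrite /left_slice -cosum_mull (@cosum_out _ _ Delta H F^o h) //.
transitivity (phi (cop (fun u v => h (L * v) *: u) L)).
  rewrite (@cosum_out _ _ Delta H F^o phi) //; apply: (@eq_cosum F H Delta F^o) => u v.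
  by rewrite -scalerAr !scalar_Z // mulrC.
by rewrite -(antipode_formula cA aA Ll AL) SL scalar_Z // mulrC.
Qed.

Lemma antipode_fixes_iff :
  S L = L <-> teq [seq (p.1, L * p.2) | p <- Delta L] [:: (L, L)].
Proof.
have [n [a [xi [sA A1 AM cA aA]]]] := integral_algebraP.
have AL := integral_algebra_mem; have [L0 _] := intL.
split=> [SL|]; last exact: (antipode_fixes sA A1 AM cA aA AL L0 integral_algebra_left).
exact: (right_integral_teq cA aA AL (integral_algebra_right SL)).
Qed.

(** Idempotence forces eps(L) = 1. The element [R] that represents the counit is a nonzero right
    integral; computing R L in two ways gives R = eps(R) L, so [L] is a right integral too. *)
Lemma idempotent_integral_two_sided : L * L = L -> two_sided_grouplike_projection Delta L.
Proof.
move=> LL; have [n [a [xi [sA A1 AM cA aA]]]] := integral_algebraP.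
have AL := integral_algebra_mem; have [L0 intL'] := intL.
have Ll := integral_algebra_left.
have eL : eps L = 1.
  have := Ll L AL; rewrite LL => e; apply/eqP; rewrite -subr_eq0; apply/eqP.
  have : (eps L - 1) *: L = 0 by rewrite scalerBl -e scale1r subrr.
  by move=> /eqP; rewrite scaler_eq0 => /orP [/eqP //|/eqP].
have [R [AR RE]] := haar_represents_left hopf wf sh h1 hinv sA A1 AM cA aA le.
have hR1 : h R = 1 by rewrite -[R]mulr1 RE // (eps_1 hopf).
have R0 : R <> 0 by move=> R0; move/eqP: hR1; rewrite R0 scalar_0 // eq_sym oner_eq0.
have Rr : forall x, integral_algebra x -> R * x = eps x *: R.
  apply: (haar_right_integral sA A1 AM cA aA AR) => x Ax.
  by rewrite RE // hR1 mulr1.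
have RL : R = eps R *: L by rewrite -Ll // Rr // eL scale1r.
have eR : eps R != 0 by apply/eqP => eR; apply: R0; rewrite RL eR scale0r.
have Lr x : integral_algebra x -> L * x = eps x *: L.
  move=> Ax; apply: (scalerI eR); rewrite scalerA mulrC -scalerA -RL scalerAl -RL.
  exact: Rr.
have rt := right_integral_teq cA aA AL Lr.
have [t1 t2] := two_sided_of_integral sA A1 AM cA aA AL Ll Lr (proj2 antipode_fixes_iff rt).
by split.
Qed.

End IntegralType.

(** On [A], S^2 is the Nakayama automorphism of [h], that is h(x y) = h(y S^2(x)), and nondegeneracy
    provides images and preimages inside [A]. *)
Lemma unimodular_antipode_square (A : H -> Prop) : left_coideal_subalgebra Delta A ->
  finite_dim A -> unimodular eps A -> forall x, A x <-> exists a, A a /\ x = S (S a).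
Proof.
have le := eps_scalar hopf; have lS := antipode_linear hopf.
move=> [sA [A1 [AM coA]]] [k [v [Av vA]]] uni.
have cA : costable A.
  move=> phi sp x Ax; have [t [At Dt]] := coA x Ax.
  rewrite /left_slice /cosum (Dt H (fun a b => phi a *: b)); last by lin.
  rewrite big_seq; apply: (@subspace_sum F H A _ _ (fun p => p \in t) (fun p => phi p.1) snd) => //.
have [n [a [xi aA]]] := coordinates_exist (s := v) sA vA.
have [L [AL LE]] := haar_represents_right hopf wf sh h1 hinv sA A1 AM cA aA le.
have hL : h L = 1 by rewrite -[L]mul1r LE // (eps_1 hopf).
have L0 : L <> 0 by move=> L0; move/eqP: hL; rewrite L0 scalar_0 // eq_sym oner_eq0.
have Ll x : A x -> x * L = eps x *: L.
  move=> Ax; apply/eqP; rewrite -subr_eq0; apply/eqP.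
  apply: (haar_nondegenerate hopf wf sh h1 hinv sA A1 AM cA aA).
    by apply: subspaceB => //; [exact: AM|exact: subspaceZ].
  move=> z Az; rewrite mulrBr scalar_B // mulrA LE; last exact: AM.
  by rewrite -scalerAr scalar_Z // LE // (eps_mul hopf) mulrC subrr.
have Lr : forall x, A x -> L * x = eps x *: L by apply/(uni L AL).
(* From S(x) = L_1 h(x L_2) follows S(S(x)) = S(L_1) h(x L_2) = S(L_1) h(L_2 x') = x'. The last
   equality uses [L] as a right integral, which is where unimodularity enters. *)
have SSE x x' : A x -> A x' -> (forall y, A y -> h (x * y) = h (y * x')) -> S (S x) = x'.
  move=> Ax Ax' e.
  have := antipode_formula cA aA Ll Ax; rewrite hL scale1r => ->.
  have := antipode_formula_right cA aA Lr Ax'; rewrite hL scale1r => {1}->.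
  rewrite (@cosum_out _ _ Delta H H S) //.
  apply: (eq_cosum_in cA aA) => //; [by lin|by lin|] => u w Aw.
  by rewrite linear_Z // e.
move=> x; split=> [Ax|[y [Ay ->]]].
  have [|y [Ay yE]] := haar_represents_left hopf wf sh h1 hinv sA A1 AM cA aA (lam := fun y => h (y * x)).
    by lin.
  by exists y; split=> //; rewrite (SSE y x).
have [|z [Az zE]] := haar_represents_right hopf wf sh h1 hinv sA A1 AM cA aA (lam := fun z => h (y * z)).
  by lin.
by rewrite (SSE y z) // => w Aw; rewrite zE.
Qed.

End LeftIntegrals.

Theorem mainTheorem18 (F : fieldType) (H : algType F)
  (Delta : H -> seq (H * H)) (eps : H -> F) (S : H -> H)
  (hopf : is_hopf Delta eps S)
  (cosemi : cosemisimple Delta) (wf : weakly_finite H) :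
  (forall L : H, integral_type Delta L ->
     (S L = L <-> teq [seq (p.1, L * p.2) | p <- Delta L] [:: (L, L)])) /\
  (forall A : H -> Prop, left_coideal_subalgebra Delta A -> finite_dim A ->
     unimodular eps A ->
     forall x, A x <-> exists a, A a /\ x = S (S a)) /\
  (forall P : H, P * P = P -> integral_type Delta P ->
     two_sided_grouplike_projection Delta P).
Proof.
have [h [sh h1 hinv]] := haar_exists hopf cosemi.
split; last split.
- by move=> L intL; exact: (antipode_fixes_iff hopf wf sh h1 hinv intL).
- by move=> A cA fA uA; exact: (unimodular_antipode_square hopf wf sh h1 hinv cA fA uA).
- by move=> P PP intP; exact: (idempotent_integral_two_sided hopf wf sh h1 hinv intP PP).
Qed.
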